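(* Let $I\subseteq\mathbb{R}$ be a nonempty interval and let $f:I\to\mathbb{R}$ be an operator convex function. For every $\lambda\in(0,1)$ and all $A,B\in\mathcal{S}_I(H)$, $$f\big(A\nabla_\lambda B\big)\le\int_0^1 f\big(A\nabla_t B\big)\,d\eta_\lambda(t)\le f(A)\nabla_\lambda f(B),$$ where $\eta_\lambda$ is the probability measure on $[0,1]$ given by $d\eta_\lambda(t)=\frac{\lambda}{1-\lambda}\,t^{\frac{2\lambda-1}{1-\lambda}}\,dt$. If $f$ is operator concave, both inequalities are reversed.
   Context: $H$ is a complex Hilbert space, $\mathcal{B}(H)$ the bounded linear operators on $H$. For self-adjoint operators, $A\le B$ means that $B-A$ is positive (i.e. self-adjoint with $\langle (B-A)x,x\rangle\ge 0$ for all $x\in H$). For an interval $I$, $\mathcal{S}_I(H)$ is the set of self-adjoint operators in $\mathcal{B}(H)$ with spectrum contained in $I$; for $f:I\to\mathbb{R}$ (continuous) and $A\in\mathcal{S}_I(H)$, $f(A)$ is defined by the continuous functional calculus. $f$ is operator convex (resp. concave) on $I$ if $f((1-\lambda)A+\lambda B)\le$ (resp. $\ge$) $(1-\lambda)f(A)+\lambda f(B)$ for all $A,B\in\mathcal{S}_I(H)$, $\lambda\in[0,1]$. For $X,Y\in\mathcal{B}(H)$ and $\lambda\in[0,1]$, $X\nabla_\lambda Y:=(1-\lambda)X+\lambda Y$. Integrals of operator-valued functions are taken in the norm (Bochner) sense. *)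

(* Defs.v *)
From HB Require Import structures.
From mathcomp Require Import all_boot all_order all_algebra.
From mathcomp Require Import sesquilinear complex.
From mathcomp Require Import all_classical all_reals all_analysis.
From mathcomp Require Import measurable_realfun.
Set Implicit Arguments.
Unset Strict Implicit.
Unset Printing Implicit Defensive.
Import Order.TTheory GRing.Theory Num.Theory.
Import numFieldNormedType.Exports.

Local Open Scope classical_set_scope.
Local Open Scope complex_scope.
Local Open Scope ring_scope.

HB.mixin Record CompleteNormedModule_isHilbert (R : realType) H
    of CompleteNormedModule R[i] H := {
  hdot : {dot H for Num.conj};
  hdot_norm : forall x : H, `|x| ^+ 2 = hdot x x
}.

#[short(type="hilbertType")]
HB.structure Definition Hilbert (R : realType) :=
  {H of CompleteNormedModule R[i] H & CompleteNormedModule_isHilbert R H}.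

Section RealNorm.
Variables (R : realType) (V : normedModType R[i]).
Implicit Types x y : V.

(* The norm of a normed module over R[i] takes its values in R[i]. *)
Definition rnorm x : R := complex.Re `|x|.

Lemma rnormE x : (rnorm x)%:C = `|x|.
Proof. by rewrite /rnorm RRe_real// realE normr_ge0. Qed.

Lemma rnorm_ge0 x : 0 <= rnorm x.
Proof. by rewrite -lecR rnormE normr_ge0. Qed.

Lemma rnorm0 : rnorm (0 : V) = 0. Proof. by rewrite /rnorm normr0. Qed.

Lemma rnorm_eq0 x : rnorm x = 0 -> x = 0.
Proof. by move=> x0; apply/normr0_eq0; rewrite -rnormE x0. Qed.

Lemma rnormD x y : rnorm (x + y) <= rnorm x + rnorm y.
Proof. by rewrite -lecR rmorphD/= !rnormE ler_normD. Qed.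

Lemma rnormZ (a : R[i]) x : rnorm (a *: x) = complex.Re `|a| * rnorm x.
Proof. by apply: complexI; rewrite rmorphM/= !rnormE normrZ. Qed.

End RealNorm.

Section BoundedOperators.
Variables (R : realType) (H : normedModType R[i]).

Definition bounded_linear : {pred (H -> H)} :=
  mem [set T : H -> H |
    linear T /\ exists M : R, forall x, `|T x| <= M%:C * `|x|].
Definition bounded_linear_key : pred_key bounded_linear. Proof. exact. Qed.
Canonical bounded_linear_keyed := KeyedPred bounded_linear_key.

Record bop := BOp { bop_fun :> H -> H; bopP : bop_fun \in bounded_linear }.

HB.instance Definition _ := [isSub for bop_fun].
HB.instance Definition _ := [Choice of bop by <:].

Lemma bounded_linearP (T : H -> H) : T \in bounded_linear <->
  linear T /\ exists2 M : R, 0 <= M & forall x, rnorm (T x) <= M * rnorm x.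
Proof.
rewrite /bounded_linear inE; split=> -[lT]; last first.
  by move=> [M M0 MT]; split=> //; exists M => x; rewrite -!rnormE -rmorphM/= lecR.
move=> [M MT]; split=> //; exists `|M| => // x; apply: (@le_trans _ _ (M * rnorm x)).
  by rewrite -lecR rmorphM/= !rnormE.
by rewrite ler_wpM2r ?rnorm_ge0 ?ler_norm.
Qed.

Lemma bounded_linear_submod_closed : submod_closed bounded_linear.
Proof.
split=> [|a S T].
  apply/bounded_linearP; split; first by move=> a x y; rewrite /= scaler0 addr0.
  by exists 0 => // x; rewrite rnorm0 mul0r.
move=> /bounded_linearP[lS [M M0 MS]] /bounded_linearP[lT [N N0 NT]].
apply/bounded_linearP; split.
  move=> b x y; rewrite !fctE lS lT !scalerDr !scalerA mulrC addrACA.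
  by [].
exists (complex.Re `|a| * M + N).
  rewrite addr_ge0// mulr_ge0//.
  by rewrite -lecR RRe_real ?realE normr_ge0.
move=> x; rewrite fctE (le_trans (rnormD _ _))// mulrDl lerD// rnormZ -mulrA.
by rewrite ler_wpM2l// -lecR RRe_real ?realE normr_ge0.
Qed.

HB.instance Definition _ := GRing.isSubmodClosed.Build R[i] (H -> H)
  bounded_linear bounded_linear_submod_closed.
HB.instance Definition _ := [SubChoice_isSubLmodule of bop by <:].

Implicit Types S T : bop.

Lemma bop_linear T : linear T.
Proof. by case/bounded_linearP: (bopP T). Qed.

HB.instance Definition _ T := GRing.isLinear.Build _ _ _ _ (T : H -> H) (bop_linear T).

Lemma bop_bounded T :
  exists2 M : R, 0 <= M & forall x, rnorm (T x) <= M * rnorm x.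
Proof. by case/bounded_linearP: (bopP T). Qed.

Lemma bop_eqP S T : S = T <-> S =1 T.
Proof. by split=> [->//|ST]; apply/val_inj/funext. Qed.

Lemma bopDE S T x : (S + T) x = S x + T x. Proof. by []. Qed.
Lemma bopNE T x : (- T) x = - T x. Proof. by []. Qed.
Lemma bopBE S T x : (S - T) x = S x - T x. Proof. by []. Qed.
Lemma bopZE a T x : (a *: T) x = a *: T x. Proof. by []. Qed.
Lemma bop0E x : (0 : bop) x = 0. Proof. by []. Qed.

Lemma bop_id_subproof : (id : H -> H) \in bounded_linear.
Proof. by apply/bounded_linearP; split=> //; exists 1 => // x; rewrite mul1r. Qed.
Definition bop_id := BOp bop_id_subproof.

Lemma bop_comp_subproof S T : (S \o T : H -> H) \in bounded_linear.
Proof.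
apply/bounded_linearP; split; first by move=> a x y; rewrite /= !linearP.
have [M M0 MS] := bop_bounded S; have [N N0 NT] := bop_bounded T.
exists (M * N); first exact: mulr_ge0.
by move=> x; rewrite (le_trans (MS _))// -mulrA ler_wpM2l.
Qed.
Definition bop_comp S T := BOp (bop_comp_subproof S T).

Lemma bop_compA : associative bop_comp. Proof. by move=> A B C; apply/bop_eqP. Qed.
Lemma bop_comp1o : left_id bop_id bop_comp. Proof. by move=> A; apply/bop_eqP. Qed.
Lemma bop_compo1 : right_id bop_id bop_comp. Proof. by move=> A; apply/bop_eqP. Qed.
Lemma bop_compDl : left_distributive bop_comp +%R.
Proof. by move=> A B C; apply/bop_eqP. Qed.
Lemma bop_compDr : right_distributive bop_comp +%R.
Proof. by move=> A B C; apply/bop_eqP => x; exact: (linearD A). Qed.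

(* Only a pzRingType: the operators on the zero space form the zero ring. *)
HB.instance Definition _ := GRing.Zmodule_isPzRing.Build bop
  bop_compA bop_comp1o bop_compo1 bop_compDl bop_compDr.

Lemma bop1E x : (1 : bop) x = x. Proof. by []. Qed.
Lemma bopME S T x : (S * T) x = S (T x). Proof. by []. Qed.

Definition opnorm T : R := sup [set rnorm (T x) | x in [set x | rnorm x <= 1]].

Lemma opnorm_has_sup T : has_sup [set rnorm (T x) | x in [set x | rnorm x <= 1]].
Proof.
split; first by exists (rnorm (T 0)), 0 => //=; rewrite rnorm0.
have [M M0 MT] := bop_bounded T; exists M => _ [x /= x1 <-].
by rewrite (le_trans (MT _))// -[leRHS]mulr1 ler_wpM2l.
Qed.

Lemma opnorm_ge0 T : 0 <= opnorm T.
Proof.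
apply: (@le_trans _ _ (rnorm (T 0))); first exact: rnorm_ge0.
by apply: (sup_upper_bound (opnorm_has_sup T)); exists 0 => //=; rewrite rnorm0.
Qed.

Lemma rnorm_bop_le T x : rnorm (T x) <= opnorm T * rnorm x.
Proof.
have [->|x0] := eqVneq x 0; first by rewrite linear0 rnorm0 mulr0.
have nx0 : 0 < rnorm x.
  rewrite lt_def rnorm_ge0 andbT; apply: contra_neq x0; exact: rnorm_eq0.
rewrite -ler_pdivrMr//.
have ninv : complex.Re `|(rnorm x)^-1%:C : R[i]| = (rnorm x)^-1.
  by rewrite ger0_norm// lecR invr_ge0 ltW.
apply: (sup_upper_bound (opnorm_has_sup T)).
exists ((rnorm x)^-1%:C *: x) => /=.
  by rewrite rnormZ ninv mulVf ?gt_eqF.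
by rewrite linearZ/= rnormZ ninv mulrC.
Qed.

Lemma opnorm_le T (M : R) : 0 <= M ->
  (forall x, rnorm (T x) <= M * rnorm x) -> opnorm T <= M.
Proof.
move=> M0 MT; apply: ge_sup; first by case: (opnorm_has_sup T).
by move=> _ [x /= x1 <-]; rewrite (le_trans (MT _))// -[leRHS]mulr1 ler_wpM2l.
Qed.

Lemma opnormD S T : (opnorm (S + T))%:C <= (opnorm S)%:C + (opnorm T)%:C.
Proof.
rewrite -rmorphD/= lecR opnorm_le ?addr_ge0 ?opnorm_ge0// => x.
by rewrite bopDE (le_trans (rnormD _ _))// mulrDl lerD// rnorm_bop_le.
Qed.

Lemma opnormZ (a : R[i]) T : (opnorm (a *: T))%:C = `|a| * (opnorm T)%:C.
Proof.
have ZE x : rnorm ((a *: T) x) = rnorm (a : R[i]^o) * rnorm (T x).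
  by rewrite bopZE rnormZ.
rewrite -(rnormE (a : R[i]^o)); have r_ge0 := rnorm_ge0 (a : R[i]^o).
set r := rnorm (a : R[i]^o) in ZE r_ge0 *.
rewrite -rmorphM/=; congr (_%:C); apply/eqP; rewrite eq_le; apply/andP; split.
  apply: opnorm_le => [|x]; first by rewrite mulr_ge0 ?opnorm_ge0.
  by rewrite ZE -mulrA ler_wpM2l// rnorm_bop_le.
have [->|r0] := eqVneq r 0; first by rewrite mul0r opnorm_ge0.
have rp : 0 < r by rewrite lt_def r0.
rewrite mulrC -ler_pdivlMr// opnorm_le ?divr_ge0 ?opnorm_ge0// => x.
by rewrite mulrAC ler_pdivlMr// mulrC -ZE rnorm_bop_le.
Qed.

Lemma opnorm_eq0 T : (opnorm T)%:C = 0 -> T = 0.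
Proof.
move=> T0; have {}T0 : opnorm T = 0 by apply: complexI; rewrite T0.
apply/bop_eqP => x; apply: rnorm_eq0; apply/eqP.
by rewrite eq_le rnorm_ge0 andbT (le_trans (rnorm_bop_le _ _))// T0 mul0r.
Qed.

HB.instance Definition _ := Lmodule_isNormed.Build R[i] bop
  opnormD opnormZ opnorm_eq0.

Lemma rnorm_bop T : rnorm T = opnorm T. Proof. by []. Qed.

End BoundedOperators.

Section BopComplete.
Variables (R : realType) (H : completeNormedModType R[i]).
Local Notation bop := (bop H).

Section Limit.
Variables (F : set_system bop) (FF : ProperFilter F).
Hypothesis Fc : cauchy F.

Let Fex (e : R[i]) : 0 < e -> exists T, F (ball T e).
Proof. by move=> e0; have /cauchyP := Fc; exact. Qed.

Let evF (x : H) : set_system H := (fun T : bop => T x) @ F.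

Let normB (S T : bop) (x : H) : `|S x - T x| <= `|S - T| * `|x|.
Proof. by rewrite -!rnormE -rmorphM/= lecR; exact: (rnorm_bop_le (S - T)). Qed.

Let evF_cvg (x : H) : cvg (evF x).
Proof.
apply: cauchy_cvg; apply/cauchy_exP => e e0.
have d0 : 0 < e / (1 + `|x|) by rewrite divr_gt0// ltr_pwDl.
have [T FT] := Fex d0; exists (T x); rewrite /evF /fmap/= /nbhs/=.
apply: filterS FT => S /=; rewrite -!ball_normE/= => TS.
apply: (le_lt_trans (normB _ _ _)).
have [->|x0] := eqVneq x 0; first by rewrite normr0 mulr0.
apply: (@lt_trans _ _ (e / (1 + `|x|) * `|x|)).
  by rewrite ltr_pM2r// normr_gt0.
by rewrite mulrAC ltr_pdivrMr ?ltr_pwDl// ltr_pM2l// ltrDr.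
Qed.

Let L (x : H) : H := lim (evF x).

Let L_cvg (x : H) : (T x @[T --> F]) --> L x.
Proof. exact: evF_cvg. Qed.

Let L_linear : linear L.
Proof.
move=> a x y; apply: cvg_lim => //; rewrite /evF.
under eq_cvg do rewrite linearP.
by apply: cvgD; [apply: cvgZr; exact: L_cvg | exact: L_cvg].
Qed.

Let L_close (T : bop) (e : R[i]) : 0 < e -> F (ball T e) ->
  forall x, `|T x - L x| <= e * `|x|.
Proof.
move=> e0 FT x; apply/ler_addgt0Pr => d d0.
near F => S.
rewrite -(subrK (S x) (T x)) -addrA (le_trans (ler_normD _ _))// lerD//.
  apply: (le_trans (normB _ _ _)); rewrite ler_wpM2r//.
  have : ball T e S by near: S.
  by rewrite -ball_normE/= => /ltW.
rewrite distrC ltW//; near: S.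
by move/cvgr_dist_lt : (@L_cvg x); apply.
Unshelve. all: by end_near. Qed.

Let L_bounded : L \in @bounded_linear R H.
Proof.
apply/bounded_linearP; split; first exact: L_linear.
have [T FT] := Fex ltr01; exists (opnorm T + 1).
  by rewrite addr_ge0 ?opnorm_ge0.
move=> x; rewrite -(subrK (T x) (L x)) addrC mulrDl (le_trans (rnormD _ _))//.
rewrite lerD ?rnorm_bop_le// -lecR rmorphM/= !rnormE distrC.
exact: L_close.
Qed.

Lemma bop_cauchy_cvg : cvg F.
Proof.
apply/cvg_ex; exists (BOp L_bounded).
apply/cvg_ballP => e e0.
have e20 : 0 < e / 2 by rewrite divr_gt0.
have [T FT] := Fex e20.
apply: filterS (FT) => S; rewrite -!ball_normE/= => TS.
rewrite -(subrK T (BOp L_bounded)) -addrA (le_lt_trans (ler_normD _ _))//.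
rewrite (splitr e) ler_ltD// -rnormE -(@RRe_real _ (e / 2)) ?gtr0_real// lecR.
have h_ge0 : 0 <= complex.Re (e / 2) by rewrite -lecR RRe_real ?gtr0_real// ltW.
rewrite rnorm_bop opnorm_le// => x.
rewrite -lecR rmorphM/= !rnormE RRe_real ?gtr0_real//.
by rewrite -[leLHS]/(`|L x - T x|) distrC; exact: L_close.
Qed.

End Limit.

HB.instance Definition _ := Uniform_isComplete.Build bop bop_cauchy_cvg.

End BopComplete.

Section Eta.
Context {R : realType}.
Variables (l : R) (l01 : 0 < l < 1).
Local Notation mu := (@lebesgue_measure R).

Definition eta_pdfT (t : R) : R :=
  l / (1 - l) * t `^ ((2 * l - 1) / (1 - l)).
Definition eta_pdf : R -> R := eta_pdfT \_ `[0, 1].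

Definition eta of (0 < l < 1) : set R -> \bar R :=
  fun U => (\int[mu]_(t in U) (eta_pdf t)%:E)%E.

Let c : R := l / (1 - l).

Let c_gt0 : 0 < c.
Proof. by case/andP: l01 => l0 l1; rewrite divr_gt0 ?subr_gt0. Qed.

Let eta_pdfTE t : eta_pdfT t = c * t `^ (c - 1).
Proof.
rewrite /eta_pdfT /c; congr (_ * _ `^ _).
have l1 : 1 - l != 0 by case/andP: l01 => _ l1; rewrite gt_eqF ?subr_gt0.
by apply: (mulIf l1); rewrite divfK// mulrBl divfK// mul1r opprB addrA mulr2n mulrDl mul1r.
Qed.

Let eta_pdfT_ge0 t : 0 <= eta_pdfT t.
Proof. by rewrite eta_pdfTE mulr_ge0 ?powR_ge0 ?ltW. Qed.

Lemma eta_pdf_ge0 t : 0 <= eta_pdf t.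
Proof. by apply: restrict_ge0 => {}t _; exact: eta_pdfT_ge0. Qed.

Let measurable_eta_pdfT : measurable_fun [set: R] eta_pdfT.
Proof. by apply: measurable_funM => //; exact: measurable_powR. Qed.

Lemma measurable_eta_pdf : measurable_fun [set: R] eta_pdf.
Proof. by apply/measurable_restrict => //; exact: measurable_funTS. Qed.

Let integral_eta_pdfT_itv (a : R) : 0 < a < 1 ->
  (\int[mu]_(t in `[a, 1%R]) (eta_pdfT t)%:E = (1 - a `^ c)%:E)%E.
Proof.
move=> /andP[a0 a1].
have cont (p x : R) : 0 < x -> {for x, continuous (@powR R ^~ p)}.
  move=> x0; apply/differentiable_continuous/derivable1_diffP.
  by apply: derivable_powR; rewrite in_itv/= andbT.
rewrite (@continuous_FTC2 _ _ (@powR R ^~ c))//.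
- by rewrite powR1 EFinB.
- apply: continuous_in_subspaceT => x; rewrite inE/= in_itv/= => /andP[ax _].
  by apply: cvgM; [exact: cvg_cst|apply: cont; exact: lt_le_trans ax].
- split.
  + move=> x; rewrite in_itv/= => /andP[ax _].
    by apply: derivable_powR; rewrite in_itv/= andbT (lt_trans a0).
  + by apply: cvg_at_right_filter; exact: cont.
  + by apply: cvg_at_left_filter; exact: cont.
- move=> x; rewrite in_itv/= => /andP[ax _].
  by rewrite eta_pdfTE powR_derive1// in_itv/= andbT (lt_trans a0).
Qed.

Lemma integral_eta_pdf : (\int[mu]_t (eta_pdf t)%:E = 1)%E.
Proof.
have -> : (\int[mu]_t (eta_pdf t)%:E = \int[mu]_(t in `[0%R, 1%R]) (eta_pdfT t)%:E)%E.
  rewrite [RHS]integral_mkcond; apply: eq_integral => t _.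
  by rewrite /eta_pdf restrict_EFin.
have mE (D : set R) : measurable_fun D (EFin \o eta_pdfT).
  by apply/measurable_EFinP; exact: measurable_funTS.
rewrite -integral_itv_obnd_cbnd//.
pose F (n : nat) : set R := `[n.+2%:R^-1, 1]%classic.
have FU : `]0, 1]%classic = \bigcup_n F n.
  apply/seteqP; split => x /=.
    rewrite in_itv/= => /andP[x0 x1]; exists (Num.truncn x^-1) => //=.
    rewrite /F/= in_itv/= x1 andbT -[leRHS]invrK lef_pV2 ?posrE ?invr_gt0//.
    rewrite ltW// (lt_le_trans (truncnS_gt _))// ler_nat.
    by [].
  move=> [n _]; rewrite /F/= !in_itv/= => /andP[nx ->]; rewrite andbT.
  by rewrite (lt_le_trans _ nx).
rewrite FU.
have cvgF : (\int[mu]_(t in F n) (eta_pdfT t)%:E @[n --> \oo] -->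
    \int[mu]_(t in \bigcup_n F n) (eta_pdfT t)%:E)%E.
  apply: ge0_nondecreasing_set_cvg_integral => //.
  - apply/nondecreasing_seqP => n; rewrite subsetEset.
    by apply: subset_itvr; rewrite bnd_simp lef_pV2 ?posrE// ler_nat.
  - by move=> n; exact: measurable_itv.
  - by move=> n; exact: mE.
  - by move=> n x _; rewrite lee_fin.
have cvg1 : (\int[mu]_(t in F n) (eta_pdfT t)%:E @[n --> \oo] --> 1)%E.
  under eq_cvg do rewrite integral_eta_pdfT_itv ?invr_gt0 ?ltr0n ?invf_lt1 ?ltr1n//.
  apply: cvg_EFin; first exact: nearW.
  rewrite -[X in _ --> X]subr0; apply: cvgB; first exact: cvg_cst.
  apply: ((cvg_at_rightP (fun a : R => a `^ c) 0 0).1 (powR_cvg0 c_gt0)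
    (fun n => n.+2%:R^-1)).
  split=> [n|]; first by rewrite invr_gt0.
  by have := @cvg_harmonic R; rewrite -cvg_shiftS.
exact: (cvg_unique _ cvgF cvg1).
Qed.

Let eta0 : eta l01 set0 = 0%E.
Proof. by rewrite /eta integral_set0. Qed.

Let eta_ge0 U : (0 <= eta l01 U)%E.
Proof. by apply: integral_ge0 => t _; rewrite lee_fin eta_pdf_ge0. Qed.

Let eta_sigma_additive : semi_sigma_additive (eta l01).
Proof.
move=> /= F mF tF mUF; rewrite /eta; apply: cvg_toP.
  apply: ereal_nondecreasing_is_cvgn => m n mn.
  apply: lee_sum_nneg_natr => // k _ _; apply: integral_ge0 => /= x Fkx.
  by rewrite lee_fin eta_pdf_ge0.
rewrite ge0_integral_bigcup//=.
- by apply/measurable_funTS/measurableT_comp => //; exact: measurable_eta_pdf.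
- by move=> x _; rewrite lee_fin eta_pdf_ge0.
Qed.

HB.instance Definition _ := isMeasure.Build _ _ _
  (eta l01) eta0 eta_ge0 eta_sigma_additive.

HB.instance Definition _ :=
  @Measure_isProbability.Build _ _ R (eta l01) integral_eta_pdf.

End Eta.

Section Bochner.
Context {d : measure_display} {T : measurableType d} {R : realType}.
Variables (V : completeNormedModType R[i]) (mu : {measure set T -> \bar R}).
Variable D : set T.
Implicit Types (s : {fimfun T >-> V}) (F : T -> V).

Definition bochner_simple s := forall y : V, measurable (s @^-1` [set y]) /\
  (y != 0 -> (mu (D `&` s @^-1` [set y]) < +oo)%E).

Definition simple_bochner_integral s : V :=
  \sum_(y \in range s) (fine (mu (D `&` s @^-1` [set y])))%:C *: y.

(* The library's integral of a nonnegative function is a lower integral; the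
   almost everywhere convergence makes F strongly measurable, and hence the
   integrands below measurable up to a negligible set. *)
Definition bochner_approx (s : nat -> {fimfun T >-> V}) F :=
  [/\ forall n, bochner_simple (s n),
      {ae mu, forall t, D t -> s n t @[n --> \oo] --> F t}
    & (\int[mu]_(t in D) (rnorm (F t - s n t))%:E @[n --> \oo] --> 0)%E].

Definition bochner_integrable F :=
  exists s : nat -> {fimfun T >-> V}, bochner_approx s F.

(* The limit does not depend on the approximating sequence, and exists as soon
   as there is one since V is complete. The value is 0 otherwise. *)
Definition bochner_integral F : V :=
  xget 0 [set v | exists2 s : nat -> {fimfun T >-> V}, bochner_approx s F &
    simple_bochner_integral (s n) @[n --> \oo] --> v].

End Bochner.

Section OperatorConvexity.
Variables (R : realType) (H : hilbertType R).
Implicit Types (A B S T : bop H) (I : set R) (f : R -> R).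

Definition selfadjoint T := forall x y : H, hdot (T x) y = hdot x (T y).

Definition positive_op T :=
  selfadjoint T /\ forall x : H, 0 <= hdot (T x) x.

Definition ople S T := positive_op (T - S).

Definition spectrum T : set R[i] :=
  [set z | ~ exists S, let U := T - z *: (1 : bop H) in S * U = 1 /\ U * S = 1].

Definition selfadjoint_in I : set (bop H) :=
  [set T | selfadjoint T /\ spectrum T `<=` [set x%:C | x in I]].

Definition horner_op (p : {poly R}) T : bop H :=
  \sum_(i < size p) (p`_i)%:C *: T ^+ i.

(* Continuous functional calculus: f(T) is the norm limit of p_n(T) for any
   polynomials p_n converging to f uniformly on the spectrum of T. For T
   self-adjoint and f continuous on the spectrum such p_n exist, and the limit
   exists and does not depend on them. *)
Definition cfc f T : bop H :=
  xget 0 [set S | exists2 p : nat -> {poly R},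
    {uniform [set x : R | spectrum T x%:C],
       (fun n x => (p n).[x]) @ \oo --> f} &
    horner_op (p n) T @[n --> \oo] --> S].

Definition nabla (t : R) A B : bop H := (1 - t)%:C *: A + t%:C *: B.

Definition operator_convex I f := forall A B (t : R),
  selfadjoint_in I A -> selfadjoint_in I B -> 0 <= t <= 1 ->
  ople (cfc f (nabla t A B)) (nabla t (cfc f A) (cfc f B)).

Definition operator_concave I f := forall A B (t : R),
  selfadjoint_in I A -> selfadjoint_in I B -> 0 <= t <= 1 ->
  ople (nabla t (cfc f A) (cfc f B)) (cfc f (nabla t A B)).

End OperatorConvexity.

(* Main.v *)
From HB Require Import structures.
Require Import Defs.
From mathcomp Require Import all_boot all_order all_algebra.
From mathcomp Require Import sesquilinear complex.
From mathcomp Require Import all_classical all_reals all_analysis.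
From mathcomp Require Import measurable_realfun ring lra.
Set Implicit Arguments.
Unset Strict Implicit.
Unset Printing Implicit Defensive.
Import Order.TTheory GRing.Theory Num.Theory.
Import numFieldNormedType.Exports.
Local Open Scope classical_set_scope.
Local Open Scope complex_scope.
Local Open Scope ring_scope.

(** Every quadratic form g(t) = <f(A nabla_t B) x, x> is a continuous convex
    function on [0, 1], the Bochner integral v satisfies <v x, x> = int g d eta,
    and eta has mean l: multiplying its density by t gives l times the density of
    parameter 1 / (2 - l). The two inequalities are therefore Jensen's inequality
    (a supporting line at l) and the chord inequality for g, integrated. In the
    concave case replace g by - g.

    That f(T) exists and is controlled by polynomials rests on
    ||p(T)|| <= max |p| over the spectrum. For a symmetric S the norm is the bound
    of the quadratic form, whose extrema lie in the spectrum because a positive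
    invertible operator is coercive; and the spectrum of p(T) is contained in the
    image of the (real) spectrum of T by factoring p - y over the complex numbers.
    The extrema of the forms of A and B lie in I, so the spectra of all
    A nabla_t B lie in one segment [a, b] of I, on which Weierstrass' theorem
    applies. This also makes t |-> f(A nabla_t B) uniformly continuous, hence a
    uniform limit of step functions. The integrals of these steps form a Cauchy
    sequence: they are self-adjoint, and their quadratic forms are scalar
    integrals. *)

(** * The real inner product, symmetric operators and their quadratic forms *)

Section RealDot.
Variables (R : realType) (H : hilbertType R).
Implicit Types (x y z : H) (S T : bop H).

(** Only the real part is kept: it is a real inner product with the same norm, so all estimates
    become ordered arithmetic in [R]. *)
Definition rdot x y : R := complex.Re (hdot x y).

Lemma rdotDl x y z : rdot (x + y) z = rdot x z + rdot y z.
Proof. by rewrite /rdot linearDl raddfD. Qed.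

Lemma rdotNl x y : rdot (- x) y = - rdot x y.
Proof. by rewrite /rdot linearNl raddfN. Qed.

Lemma rdotBl x y z : rdot (x - y) z = rdot x z - rdot y z.
Proof. by rewrite rdotDl rdotNl. Qed.

Lemma rdotZl (a : R) x y : rdot (a%:C *: x) y = a * rdot x y.
Proof.
rewrite /rdot linearZl_LR/=; case: (hdot x y) => u v /=.
by rewrite mul0r subr0.
Qed.

Lemma rdotC x y : rdot x y = rdot y x.
Proof. by rewrite /rdot hermC/= expr0 mul1r; case: (hdot y x). Qed.

Lemma rdotDr x y z : rdot x (y + z) = rdot x y + rdot x z.
Proof. by rewrite rdotC rdotDl !(rdotC x). Qed.

Lemma rdotNr x y : rdot x (- y) = - rdot x y.
Proof. by rewrite rdotC rdotNl rdotC. Qed.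

Lemma rdotBr x y z : rdot x (y - z) = rdot x y - rdot x z.
Proof. by rewrite rdotDr rdotNr. Qed.

Lemma rdotZr (a : R) x y : rdot x (a%:C *: y) = a * rdot x y.
Proof. by rewrite rdotC rdotZl rdotC. Qed.

Definition rdotE := (rdotDl, rdotBl, rdotZl, rdotNl, rdotDr, rdotBr, rdotZr, rdotNr).

Lemma rdotxx x : rdot x x = rnorm x ^+ 2.
Proof. by rewrite /rdot -hdot_norm -rnormE -rmorphXn. Qed.

Lemma rnorm_sqr_ge0 x : 0 <= rnorm x ^+ 2.
Proof. exact: sqr_ge0. Qed.

(** Cauchy-Schwarz: expand the squared norm of [|y| x - |x| y], which is nonnegative, and cancel the
    factor [|x| |y|]. *)
Lemma rdot_le x y : rdot x y <= rnorm x * rnorm y.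
Proof.
have [->|x0] := eqVneq x 0; first by rewrite rnorm0 mul0r -(scale0r x) -[0]/(0%:C) rdotZl mul0r.
have [->|y0] := eqVneq y 0; first by rewrite rnorm0 mulr0 -(scale0r x) -[0]/(0%:C) rdotZr mul0r.
have nx : 0 < rnorm x.
  by rewrite lt_def rnorm_ge0 andbT; apply: contra_neq x0; exact: rnorm_eq0.
have ny : 0 < rnorm y.
  by rewrite lt_def rnorm_ge0 andbT; apply: contra_neq y0; exact: rnorm_eq0.
have := rnorm_sqr_ge0 ((rnorm y)%:C *: x - (rnorm x)%:C *: y).
rewrite -rdotxx !rdotE !rdotxx (rdotC y x) => h.
rewrite -(ler_pM2l (mulr_gt0 nx ny)).
nra.
Qed.

Lemma rdot_abs x y : `|rdot x y| <= rnorm x * rnorm y.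
Proof.
rewrite ler_norml rdot_le andbT lerNl -rdotNl.
by rewrite (le_trans (rdot_le _ _))// /rnorm normrN.
Qed.

Definition symop T := forall x y, rdot (T x) y = rdot x (T y).

(* Complex linearity recovers Im <x, y> as Re <-i x, y>. *)
Lemma selfadjointP T : selfadjoint T <-> symop T.
Proof.
split=> [sT x y|sT x y]; first by rewrite /rdot sT.
have Im u v : complex.Im (hdot u v) = rdot ((- 'i%C) *: u) v.
  rewrite /rdot linearZl_LR/=; case: (hdot u v) => a b /=.
  by rewrite oppr0 mul0r sub0r mulN1r opprK.
apply/eqP; rewrite eq_complex; apply/andP; split; first by apply/eqP; exact: sT.
by rewrite !Im -linearZ/= sT.
Qed.

(** Symmetry makes [hdot (T x) x] equal to its own conjugate, so its imaginary part vanishes and the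
    sign of the real part decides. *)
Lemma positive_opP T :
  symop T -> (forall x, 0 <= rdot (T x) x) -> positive_op T.
Proof.
move=> sT pT; have saT := (selfadjointP T).2 sT; split=> // x.
have := pT x; rewrite /rdot.
have : hdot (T x) x = (hdot (T x) x)^*.
  by rewrite [LHS]saT hermC/= expr0 mul1r.
case: (hdot (T x) x) => a b /= [] /eqP; rewrite -addr_eq0 -mulr2n mulrn_eq0/= => /eqP ->.
by rewrite lecE/= eqxx.
Qed.

Lemma positive_op_ge0 T x : positive_op T -> 0 <= rdot (T x) x.
Proof. by case=> _ /(_ x); rewrite /rdot lecE => /andP[]. Qed.

Lemma symop1 : symop 1. Proof. by []. Qed.

Lemma symop0 : symop 0.
Proof. by move=> x y; rewrite !bop0E -(subrr x) rdotBl rdotBr !subrr. Qed.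

Lemma symopD S T : symop S -> symop T -> symop (S + T).
Proof. by move=> sS sT x y; rewrite !bopDE !rdotE sS sT. Qed.

Lemma symopN T : symop T -> symop (- T).
Proof. by move=> sT x y; rewrite !bopNE !rdotE sT. Qed.

Lemma symopB S T : symop S -> symop T -> symop (S - T).
Proof. by move=> sS sT; apply: symopD => //; exact: symopN. Qed.

Lemma symopZ (a : R) T : symop T -> symop (a%:C *: T).
Proof. by move=> sT x y; rewrite !bopZE !rdotE sT. Qed.

Lemma symopX T n : symop T -> symop (T ^+ n).
Proof.
move=> sT; elim: n => [|n IH] x y; first exact: symop1.
by rewrite exprS bopME sT IH -!bopME -exprSr -exprS.
Qed.

(* Compare the form at x + s S x and at x - s S x, with s = 1 / c. *)
Lemma opnorm_sym_le S (c : R) : 0 <= c -> symop S ->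
  (forall x, `|rdot (S x) x| <= c * rnorm x ^+ 2) -> rnorm S <= c.
Proof.
move=> c0 sS Sc; rewrite rnorm_bop.
have key s x : 4 * s * rnorm (S x) ^+ 2 <= 2 * c * (rnorm x ^+ 2 + s ^+ 2 * rnorm (S x) ^+ 2).
  have := Sc (x + s%:C *: S x); have := Sc (x - s%:C *: S x).
  rewrite !ler_norml => /andP[h1 _] /andP[_ h2].
  have Sp u : S (x + s%:C *: u) = S x + s%:C *: S u by rewrite linearD linearZ.
  have Sm u : S (x - s%:C *: u) = S x - s%:C *: S u by rewrite linearB linearZ.
  move: h1 h2; rewrite Sp Sm -!rdotxx.
  rewrite !rdotE (sS (S x) x) (rdotC (S x) x).
  move: (rdot (S (S x)) (S x)) (rdot (S x) (S x)) (rdot x (S x)) (rdot x x) (rdot (S x) x).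
  move=> a1 a2 a3 a4 a5; nra.
apply: opnorm_le => // x; rewrite -ler_sqr ?nnegrE ?mulr_ge0 ?rnorm_ge0// exprMn.
have [c0'|cn0] := eqVneq c 0.
  have := key 1 x; rewrite c0'; have := rnorm_sqr_ge0 (S x); nra.
have cp : 0 < c by rewrite lt_def cn0.
have h := ler_wpM2l (ltW cp) (key c^-1 x).
have e1 : c * (4 * c^-1 * rnorm (S x) ^+ 2) = 4 * rnorm (S x) ^+ 2 by field.
have e2 : c * (2 * c * (rnorm x ^+ 2 + c^-1 ^+ 2 * rnorm (S x) ^+ 2)) =
  2 * (c ^+ 2 * rnorm x ^+ 2) + 2 * rnorm (S x) ^+ 2 by field.
move: h; rewrite e1 e2; lra.
Qed.

Lemma rdot_bop_le T x y : `|rdot (T x) y| <= rnorm T * (rnorm x * rnorm y).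
Proof.
rewrite (le_trans (rdot_abs _ _))// mulrA ler_wpM2r ?rnorm_ge0//.
exact: rnorm_bop_le.
Qed.

(* P - K / 2 has norm at most K / 2; expand the square. *)
Lemma sqr_rnorm_le (P : bop H) (K : R) : symop P -> 0 <= K ->
  (forall x, 0 <= rdot (P x) x <= K * rnorm x ^+ 2) ->
  forall x, rnorm (P x) ^+ 2 <= K * rdot (P x) x.
Proof.
move=> sP K0 PK x.
pose S : bop H := P - (K / 2)%:C *: (1 : bop H).
have sS : symop S by apply: symopB => //; apply: symopZ; exact: symop1.
have SE u : S u = P u - (K / 2)%:C *: u by [].
have Sn : rnorm S <= K / 2.
  apply: opnorm_sym_le => // [|u]; first by rewrite divr_ge0.
  have := PK u; rewrite SE !rdotE rdotxx => /andP[? ?].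
  by rewrite ler_norml; apply/andP; split; lra.
have := rnorm_bop_le S x; rewrite -rnorm_bop => h.
have {}h : rnorm (S x) ^+ 2 <= (K / 2) ^+ 2 * rnorm x ^+ 2.
  rewrite -exprMn ler_sqr ?nnegrE ?mulr_ge0 ?divr_ge0 ?rnorm_ge0//.
  by rewrite (le_trans h)// ler_wpM2r ?rnorm_ge0.
move: h; rewrite -!rdotxx SE !rdotE (rdotC x (P x)).
move: (rdot (P x) x) (rdot x x) (rdot (P x) (P x)) => a1 a2 a3; nra.
Qed.

End RealDot.

(** * Convergence expressed through the real-valued norm *)

Section RealNormCvg.
Variables (R : realType) (V : normedModType R[i]).
Implicit Types (u : nat -> V) (v : V).

Lemma rnormN v : rnorm (- v) = rnorm v.
Proof. by rewrite /rnorm normrN. Qed.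

Lemma rnormBC v w : rnorm (v - w : V) = rnorm (w - v).
Proof. by rewrite /rnorm distrC. Qed.

Lemma rnormB_trans w v1 v2 : rnorm (v1 - v2 : V) <= rnorm (v1 - w) + rnorm (w - v2).
Proof. by rewrite (le_trans _ (rnormD _ _))// subrKA. Qed.

Lemma rnormZR (a : R) v : rnorm (a%:C *: v) = `|a| * rnorm v.
Proof. by rewrite rnormZ normc_def/= expr0n addr0 sqrtr_sqr. Qed.

(** Comparability with 0 in [R[i]] forces an element to be real; the radii of the complex-normed
    structure may thus be taken in [R]. *)
Lemma gt0_complexE (e : R[i]) : 0 < e -> exists2 r : R, 0 < r & e = r%:C.
Proof.
move=> e0; exists (complex.Re e); last by rewrite RRe_real ?gtr0_real.
by rewrite -ltcR RRe_real ?gtr0_real.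
Qed.

Lemma cvg_rnormP u v : u @ \oo --> v <->
  forall e : R, 0 < e -> exists N, forall n, (N <= n)%N -> rnorm (v - u n) <= e.
Proof.
split=> [/cvgrPdist_le uv e e0|uv].
  have e0' : 0 < e%:C by rewrite ltcR.
  have [N _ Nuv] := uv _ e0'; exists N => n Nn.
  by rewrite -lecR rnormE; exact: (Nuv n).
apply/cvgrPdist_le => e /gt0_complexE[r r0 ->].
have [N Nuv] := uv _ r0; exists N => // n /= Nn.
by rewrite -rnormE lecR Nuv.
Qed.

Lemma cvg_rnorm_le u v (w : V) (c : R) : u @ \oo --> v ->
  (exists N, forall n, (N <= n)%N -> rnorm (w - u n) <= c) -> rnorm (w - v) <= c.
Proof.
move=> /cvg_rnormP uv [N Nc]; apply/ler_addgt0Pr => e e0.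
have [M Muv] := uv _ e0; rewrite (le_trans (rnormB_trans (u (maxn M N)) _ _))//.
by rewrite lerD ?Nc ?leq_maxr// rnormBC Muv ?leq_maxl.
Qed.

End RealNormCvg.

Lemma rnorm_cauchy_cvg (R : realType) (V : completeNormedModType R[i]) (u : nat -> V) :
  (forall e : R, 0 < e -> exists N, forall m n, (N <= m)%N -> (N <= n)%N ->
     rnorm (u m - u n) <= e) -> cvg (u @ \oo).
Proof.
move=> uc; apply: cauchy_cvg; apply: cauchy_exP => e /gt0_complexE[r r0 ->].
have r20 : 0 < r / 2 by rewrite divr_gt0.
have [N Nu] := uc _ r20; exists (u N); exists N => // n /= Nn.
rewrite -ball_normE/= -rnormE ltcR (le_lt_trans (Nu _ _ _ _))//.
by rewrite ltr_pdivrMr// ltr_pMr// ltr1n.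
Qed.

(** * Submultiplicativity of the operator norm, and invertible operators *)

Section BopNorm.
Variables (R : realType) (H : normedModType R[i]).
Implicit Types S T : bop H.

Lemma rnormM_le S T : rnorm (S * T) <= rnorm S * rnorm T.
Proof.
rewrite !rnorm_bop; apply: opnorm_le => [|x]; first by rewrite mulr_ge0 ?opnorm_ge0.
rewrite bopME -mulrA (le_trans (rnorm_bop_le _ _))// ler_wpM2l ?opnorm_ge0//.
exact: rnorm_bop_le.
Qed.

Lemma rnorm1_le : rnorm (1 : bop H) <= 1.
Proof. by rewrite rnorm_bop opnorm_le// => x; rewrite mul1r. Qed.

Lemma rnormX_le T n : rnorm (T ^+ n) <= rnorm T ^+ n.
Proof.
elim: n => [|n IH]; first exact: rnorm1_le.
by rewrite !exprS (le_trans (rnormM_le _ _))// ler_wpM2l ?rnorm_ge0.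
Qed.

Lemma bop_scalerAl (a : R[i]) S T : (a *: S) * T = a *: (S * T).
Proof. exact/bop_eqP. Qed.

Lemma bop_scalerAr (a : R[i]) S T : S * (a *: T) = a *: (S * T).
Proof. by apply/bop_eqP => x; rewrite bopME !bopZE linearZ. Qed.

Definition invop T := exists S, S * T = 1 /\ T * S = 1.

Lemma invopM S T : invop S -> invop T -> invop (S * T).
Proof.
move=> [S' [S1 S2]] [T' [T1 T2]]; exists (T' * S'); split.
  by rewrite mulrA -(mulrA T') S1 mulr1.
by rewrite mulrA -(mulrA S) T2 mulr1.
Qed.

(** If [U] inverts [S * T], then [U * T] is a left inverse of [S] by commutation and [T * U] is a
    right inverse; the two must agree. *)
Lemma invop_comml S T : S * T = T * S -> invop (S * T) -> invop S.
Proof.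
move=> ST [U [U1 U2]]; exists (U * T).
have left_inv : (U * T) * S = 1 by rewrite -mulrA -ST.
split=> //; suff -> : U * T = T * U by rewrite mulrA.
by rewrite -[LHS]mulr1 -U2 !mulrA left_inv mul1r.
Qed.

Lemma invopZ (a : R[i]) T : a != 0 -> invop T -> invop (a *: T).
Proof.
move=> a0 [S [S1 S2]]; exists (a^-1 *: S).
by rewrite !bop_scalerAl !bop_scalerAr !scalerA S1 S2 mulVf// mulfV// scale1r.
Qed.

Lemma invopN T : invop T -> invop (- T).
Proof. by move=> [S [S1 S2]]; exists (- S); rewrite !mulrNN. Qed.

End BopNorm.

(** * The Neumann series *)

Section Neumann.
Variables (R : realType) (H : completeNormedModType R[i]).

(** The partial sums [u n] of the powers of [Q] are Cauchy by comparison with a geometric series,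
    and telescoping gives [(1 - Q) * u n = 1 - Q ^+ n]; the limit is the inverse. *)
Lemma neumann (Q : bop H) (q : R) : rnorm Q <= q -> q < 1 -> invop (1 - Q).
Proof.
move=> Qq q1; have q0 : 0 <= q := le_trans (rnorm_ge0 Q) Qq.
pose u n := \sum_(i < n) Q ^+ i.
have tele n : (1 - Q) * u n = 1 - Q ^+ n.
  elim: n => [|n IH]; first by rewrite /u big_ord0 mulr0 expr0 subrr.
  by rewrite /u big_ord_recr/= mulrDr IH mulrBl mul1r -exprS addrA subrK.
have comm n : u n * (1 - Q) = (1 - Q) * u n.
  rewrite /u mulr_suml mulr_sumr; apply: eq_bigr => i _.
  by rewrite mulrBl mulrBr mul1r mulr1 -exprS -exprSr.
have Qn n : rnorm (Q ^+ n) <= q ^+ n.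
  by rewrite (le_trans (rnormX_le _ _))// lerXn2r ?nnegrE ?rnorm_ge0.
have q1' : 0 < 1 - q by rewrite subr_gt0.
have geo m k : rnorm (u (m + k)%N - u m) <= q ^+ m / (1 - q).
  (* The factor [1 - q ^+ k] gives the exact sum of the geometric tail, which lets the induction on
     [k] close. *)
  suff : rnorm (u (m + k)%N - u m) <= q ^+ m * (1 - q ^+ k) / (1 - q).
    move=> /le_trans; apply; apply: ler_wpM2r; first by rewrite invr_ge0 ltW.
    by rewrite ler_piMr ?exprn_ge0// gerBl exprn_ge0.
  elim: k => [|k IH]; first by rewrite addn0 subrr rnorm0 expr0 subrr mulr0 mul0r.
  rewrite addnS /u big_ord_recr/= -/(u _) addrAC (le_trans (rnormD _ _))//.
  apply: (@le_trans _ _ (q ^+ m * (1 - q ^+ k) / (1 - q) + q ^+ (m + k))).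
    by rewrite lerD.
  by rewrite exprD exprS le_eqVlt; apply/orP; left; apply/eqP; field; rewrite gt_eqF.
have qcvg (e : R) : 0 < e -> exists N, forall n, (N <= n)%N -> q ^+ n <= e.
  move=> e0; have /cvgrPdist_le /(_ _ e0) [N _ Nq] : q ^+ n @[n --> \oo] --> 0.
    by apply: cvg_expr; rewrite ger0_norm.
  exists N => n Nn; have := Nq n Nn.
  by rewrite /= sub0r normrN ger0_norm ?exprn_ge0.
have uc : cvg (u @ \oo).
  apply: rnorm_cauchy_cvg => e e0.
  have [N Nq] := qcvg (e * (1 - q)) (mulr_gt0 e0 q1'); exists N => m n Nm Nn.
  wlog mn : m n Nm Nn / (m <= n)%N.
    move=> h; have [|/ltnW] := leqP m n; first exact: h.
    by rewrite rnormBC; exact: h.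
  rewrite rnormBC -(subnKC mn) (le_trans (geo _ _))//.
  by rewrite ler_pdivrMr// Nq.
(* An operator bounded for every [n] by a multiple of the distance from [u n] to its limit plus
   [q ^+ n] must vanish; this serves both one-sided inverse identities. *)
have small (W : bop H) (C : R) : (forall n, rnorm W <= C * rnorm (lim (u @ \oo) - u n) + q ^+ n) -> W = 0.
  move=> h; apply: rnorm_eq0; apply/eqP; rewrite eq_le rnorm_ge0 andbT.
  apply/ler_addgt0Pr => e e0; rewrite add0r.
  have e1 : 0 < e / 2 / (`|C| + 1) by rewrite !divr_gt0// ltr_wpDl.
  have e2 : 0 < e / 2 by rewrite divr_gt0.
  have [N1 Nq] := qcvg _ e2; have /cvg_rnormP/(_ _ e1)[N2 Nu] := uc.
  rewrite (le_trans (h (maxn N1 N2)))// [leRHS]splitr lerD ?Nq ?leq_maxl//.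
  have := Nu _ (leq_maxr N1 N2); rewrite ler_pdivlMr ?ltr_wpDl//; apply: le_trans.
  rewrite mulrC ler_wpM2l ?rnorm_ge0// (le_trans (ler_norm _))// lerDl.
  by [].
exists (lim (u @ \oo)); split; apply/eqP; rewrite -subr_eq0; apply/eqP;
  apply: (small _ (rnorm (1 - Q))) => n; rewrite (le_trans (rnormB_trans ((1 - Q) * u n) _ _))//;
  rewrite {2}tele [1 - Q ^+ n]addrC addrK rnormN lerD//.
  by rewrite -comm -mulrBl (le_trans (rnormM_le _ _))// mulrC.
by rewrite -mulrBr rnormM_le.
Qed.

End Neumann.

(** * Spectrum and numerical range of symmetric operators *)

Section SpectrumSym.
Variables (R : realType) (H : hilbertType R).
Implicit Types (x y : H) (S T P : bop H).

(** With [K = rnorm P + e], the form of [1 - P / K] lies between 0 and [1 - e / K], so its norm is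
    below 1 and the Neumann series inverts [P / K]. *)
Lemma coercive_invop P (e : R) : symop P -> 0 < e ->
  (forall x, e * rnorm x ^+ 2 <= rdot (P x) x) -> invop P.
Proof.
move=> sP e0 eP; pose K := rnorm P + e.
have K0 : 0 < K by rewrite ltr_wpDl ?rnorm_ge0.
pose Q : bop H := 1 - K^-1%:C *: P.
have sQ : symop Q by apply: symopB; [exact: symop1|exact: symopZ].
have Qn : rnorm Q <= 1 - e / K.
  apply: opnorm_sym_le => //.
    by rewrite subr_ge0 ler_pdivrMr// mul1r lerDr rnorm_ge0.
  move=> x; have QE : rdot (Q x) x = rnorm x ^+ 2 - K^-1 * rdot (P x) x.
    by rewrite /Q bopBE bop1E bopZE !rdotE rdotxx.
  have P1 := eP x; have P2 := rdot_bop_le P x x; have N0 := rnorm_sqr_ge0 x.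
  rewrite -expr2 in P2.
  have P3 : rdot (P x) x <= K * rnorm x ^+ 2.
    rewrite (le_trans (ler_norm _))// (le_trans P2)// ler_wpM2r// lerDl ltW//.
  rewrite QE ger0_norm; last by rewrite subr_ge0 mulrC ler_pdivrMr// mulrC.
  rewrite mulrBl mul1r lerB// (mulrC e) -mulrA.
  by rewrite ler_wpM2l// invr_ge0 ltW.
have : invop (1 - Q) by apply: (neumann Qn); rewrite gtrBl divr_gt0.
have -> : 1 - Q = K^-1%:C *: P by rewrite /Q subKr.
have KK : K%:C * K^-1%:C = 1 :> R[i] by rewrite -rmorphM mulfV ?gt_eqF.
move=> /(@invopZ _ _ K%:C); rewrite scalerA KK scale1r.
by apply; rewrite (inj_eq (@complexI _)) gt_eqF.
Qed.

(** An inverse [S] of norm [s] gives [|x| <= s |P x|], and [sqr_rnorm_le] bounds [|P x|^2] by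
    [K <P x, x>]. The added 1 keeps the constant positive when [s ^+ 2 * K] is 0. *)
Lemma pos_invop_coercive P : symop P -> (forall x, 0 <= rdot (P x) x) ->
  invop P -> exists2 e : R, 0 < e & forall x, e * rnorm x ^+ 2 <= rdot (P x) x.
Proof.
move=> sP P0 [S [SP PS]]; pose s := rnorm S; pose K := rnorm P.
have K0 : 0 <= K := rnorm_ge0 _.
have d0 : 0 < s ^+ 2 * K + 1 by rewrite ltr_wpDl// mulr_ge0 ?sqr_ge0.
exists (s ^+ 2 * K + 1)^-1; first by rewrite invr_gt0.
move=> x; rewrite mulrC ler_pdivrMr// mulrC.
have PK u : 0 <= rdot (P u) u <= K * rnorm u ^+ 2.
  by rewrite P0/= (le_trans (ler_norm _))// (le_trans (rdot_bop_le _ _ _))// expr2.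
have h := sqr_rnorm_le sP K0 PK x.
have h2 : rnorm x ^+ 2 <= s ^+ 2 * rnorm (P x) ^+ 2.
  rewrite -exprMn ler_sqr ?nnegrE ?mulr_ge0 ?rnorm_ge0//.
  by rewrite -[x in X in X <= _](bop1E x) -SP bopME; exact: rnorm_bop_le.
rewrite (le_trans h2)// mulrDl mul1r (@le_trans _ _ (s ^+ 2 * K * rdot (P x) x))//.
  by rewrite -mulrA ler_wpM2l// sqr_ge0.
by rewrite lerDl P0.
Qed.

Definition scalop (a : R) : bop H := a%:C *: (1 : bop H).

Lemma scalopE a x : scalop a x = a%:C *: x. Proof. by []. Qed.

Lemma symop_scalop a : symop (scalop a).
Proof. by apply: symopZ; exact: symop1. Qed.

Lemma spectrumP T z : spectrum T z <-> ~ invop (T - z *: (1 : bop H)).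
Proof. by []. Qed.

(** For [z = a + i b] with [b] nonzero, [T - z] commutes with [T - (a - i b)], and their product
    [(T - a)^2 + b^2] is coercive with constant [b^2], hence invertible. *)
Lemma spectrum_real T z : symop T -> spectrum T z -> z = (complex.Re z)%:C.
Proof.
move=> sT /spectrumP Tz; have [b0|b0] := eqVneq (complex.Im z) 0.
  by case: z b0 {Tz} => a b /= ->.
exfalso; apply: Tz; case: z b0 => a b /= b0.
have [zE zE'] : (a +i* b = a%:C + 'i%C * b%:C) /\ (a -i* b = a%:C - 'i%C * b%:C).
  by split; apply/eqP; rewrite eq_complex/=; apply/andP; split; apply/eqP; ring.
set U := T - _.
pose U' : bop H := T - (a -i* b) *: (1 : bop H).
have [W WE] : exists W, W = T - scalop a by exists (T - scalop a).
have UE : U = W - ('i%C * b%:C) *: (1 : bop H).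
  by rewrite /U WE /scalop zE scalerDl opprD addrA.
have UE' : U' = W + ('i%C * b%:C) *: (1 : bop H).
  by rewrite /U' WE /scalop zE' scalerBl opprB addrA addrAC.
have UU : U * U' = W * W + scalop (b ^+ 2).
  rewrite UE UE' mulrBl !mulrDr !bop_scalerAl !bop_scalerAr !mul1r mulr1 scalerA.
  rewrite opprD addrA addrK /scalop -scaleNr; congr (_ + _ *: _).
  by apply/eqP; rewrite eq_complex/=; apply/andP; split; apply/eqP; ring.
have UU' : U * U' = U' * U.
  rewrite UU UE UE' mulrDl !mulrBr !bop_scalerAl !bop_scalerAr !mul1r mulr1 scalerA.
  rewrite addrA subrK /scalop -scaleNr; congr (_ + _ *: _).
  by apply/eqP; rewrite eq_complex/=; apply/andP; split; apply/eqP; ring.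
apply: (invop_comml UU'); rewrite UU.
have sW : symop W by rewrite WE; apply: symopB => //; exact: symop_scalop.
apply: (@coercive_invop _ (b ^+ 2)).
- by apply: symopD; [exact: (symopX 2)|exact: symop_scalop].
- by rewrite lt_def sqrf_eq0 b0 sqr_ge0.
- move=> x; rewrite bopDE bopME scalopE !rdotE sW !rdotxx lerDr.
  exact: sqr_ge0.
Qed.

(** For [y > a] the operator [y - T] is coercive with constant [y - a], hence invertible. *)
Lemma spectrum_le T (a y : R) : symop T ->
  (forall x, rdot (T x) x <= a * rnorm x ^+ 2) -> spectrum T y%:C -> y <= a.
Proof.
move=> sT Ta; rewrite leNgt => /spectrumP Ty; apply/negP => ay; apply: Ty.
rewrite -[T - _]opprB; apply: invopN; apply: (@coercive_invop _ (y - a)).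
- by apply: symopB => //; exact: symop_scalop.
- by rewrite subr_gt0.
- move=> x; rewrite bopBE bopZE bop1E !rdotE rdotxx mulrBl lerB//.
Qed.

Lemma spectrumN T z : spectrum T z -> spectrum (- T) (- z).
Proof.
move=> /spectrumP Tz; apply/spectrumP; apply: contra_not Tz => /invopN.
by rewrite scaleNr opprB addrC opprK.
Qed.

Lemma spectrum_ge T (a y : R) : symop T ->
  (forall x, a * rnorm x ^+ 2 <= rdot (T x) x) -> spectrum T y%:C -> a <= y.
Proof.
move=> sT Ta /spectrumN; rewrite -rmorphN => Ty; rewrite -lerN2.
apply: (spectrum_le (symopN sT)) Ty => x.
by rewrite bopNE rdotNl mulNr lerN2.
Qed.

(** Take for [M] the least upper bound of the form. Were [M - T] invertible, it would be coercive
    with some constant [e], and [M - e] would still be an upper bound. The nonzero vector keeps the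
    set of bounds bounded below; on the zero space the spectrum is empty. *)
Lemma max_spectrum T x0 : symop T -> x0 != 0 ->
  exists2 M : R, spectrum T M%:C & forall x, rdot (T x) x <= M * rnorm x ^+ 2.
Proof.
move=> sT x00; pose U := [set u : R | forall x, rdot (T x) x <= u * rnorm x ^+ 2].
have Npos x : x != 0 -> 0 < rnorm x ^+ 2.
  move=> xn0; rewrite exprn_gt0// lt_def rnorm_ge0 andbT.
  by apply: contra_neq xn0; exact: rnorm_eq0.
have Ulb x : x != 0 -> lbound U (rdot (T x) x / rnorm x ^+ 2).
  by move=> xn0 u Uu; rewrite ler_pdivrMr ?Npos.
have U0 : U !=set0.
  exists (rnorm T) => x; rewrite (le_trans (ler_norm _))// (le_trans (rdot_bop_le _ _ _))//.
have hU : has_inf U by split=> //; exists (rdot (T x0) x0 / rnorm x0 ^+ 2); exact: Ulb.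
have UM : U (inf U).
  move=> x; have [->|xn0] := eqVneq x 0.
    by rewrite linear0 rdotxx rnorm0 expr0n mulr0.
  by rewrite -ler_pdivrMr ?Npos//; apply: lb_le_inf => //; exact: Ulb.
exists (inf U) => //; apply/spectrumP => /invopN; rewrite opprB => iP.
have sP : symop (scalop (inf U) - T) by apply: symopB => //; exact: symop_scalop.
have [|e e0 eP] := pos_invop_coercive sP _ iP.
  by move=> x; rewrite bopBE scalopE !rdotE rdotxx subr_ge0.
suff : inf U <= inf U - e by rewrite lerDl oppr_ge0 leNgt e0.
apply: ge_inf; first by case: hU.
move=> x; have := eP x; rewrite bopBE scalopE !rdotE rdotxx; lra.
Qed.

(** The best upper bound of the form is itself a spectral point, hence at most [c]. *)
Lemma spectrum_numrange_le T (c : R) : symop T ->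
  (forall y : R, spectrum T y%:C -> y <= c) -> forall x, rdot (T x) x <= c * rnorm x ^+ 2.
Proof.
move=> sT Tc x; have [->|x0] := eqVneq x 0.
  by rewrite linear0 rdotxx rnorm0 expr0n mulr0.
have [M /Tc Mc /(_ x) /le_trans] := max_spectrum sT x0; apply.
by rewrite ler_wpM2r ?sqr_ge0.
Qed.

Lemma spectrum_numrange_ge T (c : R) : symop T ->
  (forall y : R, spectrum T y%:C -> c <= y) -> forall x, c * rnorm x ^+ 2 <= rdot (T x) x.
Proof.
move=> sT Tc x; rewrite -lerN2 -rdotNl -mulNr -bopNE.
apply: spectrum_numrange_le => [|y]; first exact: symopN.
by move=> /spectrumN; rewrite opprK -rmorphN => /Tc; rewrite lerNr.
Qed.

Lemma spectrum_rnorm_le T (c : R) : 0 <= c -> symop T ->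
  (forall y : R, spectrum T y%:C -> `|y| <= c) -> rnorm T <= c.
Proof.
move=> c0 sT Tc; apply: opnorm_sym_le => // x; rewrite ler_norml -mulNr.
rewrite spectrum_numrange_ge ?spectrum_numrange_le// => y /Tc; rewrite ler_norml.
  by case/andP.
by case/andP.
Qed.

(** The best bounds of the form, applied to [T] and to [- T], are spectral points of [T], so they
    lie in [I]. *)
Lemma numrange_in_itv (I : set R) T : I !=set0 -> selfadjoint_in I T ->
  exists a b, [/\ I a, I b & forall x, a * rnorm x ^+ 2 <= rdot (T x) x <= b * rnorm x ^+ 2].
Proof.
move=> [i0 Ii0] [/selfadjointP sT TI].
(* On the zero space the form vanishes, and any point of [I] serves as both endpoints. *)
have [[x0 x00]|] := pselect (exists x0 : H, x0 != 0); last first.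
  move=> /forallNP H0; exists i0, i0; split=> // x.
  have -> : x = 0 by apply/eqP/negPn/negP.
  by rewrite linear0 rdotxx rnorm0 expr0n mulr0 lexx.
have [b Tb bP] := max_spectrum sT x00.
have [a Ta aP] := max_spectrum (symopN sT) x00.
exists (- a), b; split.
- have [y Iy /complexI <-] : [set y%:C | y in I] (- a)%:C.
    by apply: TI; rewrite rmorphN -[T]opprK; exact: spectrumN.
  exact: Iy.
- by have [y Iy /complexI <-] := TI _ Tb.
- move=> x; rewrite bP andbT; have := aP x.
  by rewrite bopNE rdotNl mulNr lerNl.
Qed.

End SpectrumSym.

(** * Complex polynomials in an operator *)

Section ComplexHorner.
Variables (R : realType) (H : normedModType R[i]).
Implicit Types (p q : {poly R[i]}) (T : bop H).

(** Complex coefficients allow a polynomial to split into linear factors; [horner_op] is the case of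
    real coefficients. *)
Definition chorner p T : bop H := \sum_(i < size p) p`_i *: T ^+ i.

Lemma chorner_widen n p T : (size p <= n)%N ->
  chorner p T = \sum_(i < n) p`_i *: T ^+ i.
Proof.
move=> pn; rewrite /chorner (big_ord_widen _ (fun i => p`_i *: T ^+ i) pn).
rewrite big_mkcond; apply: eq_bigr => i _; case: ltnP => // /leq_sizeP -> //.
by rewrite scale0r.
Qed.

Lemma chornerD p q T : chorner (p + q) T = chorner p T + chorner q T.
Proof.
pose n := maxn (size p) (size q).
rewrite !(@chorner_widen n) ?leq_maxl ?leq_maxr ?size_polyD// -big_split/=.
by apply: eq_bigr => i _; rewrite coefD scalerDl.
Qed.

Lemma chornerZ a p T : chorner (a *: p) T = a *: chorner p T.
Proof.
rewrite (chorner_widen _ (size_scale_leq a p)) /chorner scaler_sumr.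
by apply: eq_bigr => i _; rewrite coefZ scalerA.
Qed.

Lemma chornerB p q T : chorner (p - q) T = chorner p T - chorner q T.
Proof. by rewrite -scaleN1r chornerD chornerZ scaleN1r. Qed.

Lemma chornerC a T : chorner a%:P T = a *: (1 : bop H).
Proof. by rewrite (chorner_widen _ (size_polyC_leq1 a)) big_ord1 coefC. Qed.

Lemma chornerXM p T : chorner ('X * p) T = T * chorner p T.
Proof.
rewrite (@chorner_widen (size p).+1); last first.
  by rewrite (leq_trans (size_polyMleq _ _))// size_polyX.
rewrite big_ord_recl coefXM/= scale0r add0r /chorner mulr_sumr.
by apply: eq_bigr => i _; rewrite coefXM/= bop_scalerAr -exprS.
Qed.

Lemma chornerXsubCM a p T :
  chorner (('X - a%:P) * p) T = (T - a *: (1 : bop H)) * chorner p T.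
Proof.
by rewrite mulrBl chornerB chornerXM mul_polyC chornerZ mulrBl bop_scalerAl mul1r.
Qed.

Lemma invop_chorner_prod (rs : seq R[i]) T :
  (forall z, z \in rs -> invop (T - z *: (1 : bop H))) ->
  invop (chorner (\prod_(z <- rs) ('X - z%:P)) T).
Proof.
elim: rs => [_|z rs IH rsT].
  by rewrite big_nil -[1]/(1%:P) chornerC scale1r; exists 1; rewrite mulr1.
rewrite big_cons chornerXsubCM; apply: invopM.
  by apply: rsT; rewrite mem_head.
by apply: IH => w wrs; apply: rsT; rewrite inE wrs orbT.
Qed.

End ComplexHorner.

(** * Spectral mapping and the norm bound for real polynomials *)

Section HornerOp.
Variables (R : realType) (H : hilbertType R).
Implicit Types (p q : {poly R}) (T : bop H).

Local Notation toC := (map_poly (real_complex R)).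

Lemma horner_opE p T : horner_op p T = chorner (toC p) T.
Proof.
rewrite /chorner size_map_poly; apply: eq_bigr => i _.
by rewrite coef_map.
Qed.

Lemma horner_opB p q T : horner_op (p - q) T = horner_op p T - horner_op q T.
Proof. by rewrite !horner_opE rmorphB/= chornerB. Qed.

Lemma symop_sum (J : Type) (s : seq J) (P : pred J) (F : J -> bop H) :
  (forall j, P j -> symop (F j)) -> symop (\sum_(j <- s | P j) F j).
Proof.
by move=> sF; elim/big_ind : _ => // [|S T]; [exact: symop0|exact: symopD].
Qed.

Lemma symop_horner_op p T : symop T -> symop (horner_op p T).
Proof. by move=> sT; apply: symop_sum => i _; apply: symopZ; exact: symopX. Qed.

(** Split [p - y] into linear factors over the complex numbers: if no root were a spectral point of
    [T], every factor, and hence [p(T) - y], would be invertible. A root in the spectrum is real by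
    symmetry. *)
Lemma spectrum_horner_op p T (y : R) : symop T -> spectrum (horner_op p T) y%:C ->
  exists2 x : R, spectrum T x%:C & p.[x] = y.
Proof.
move=> sT /spectrumP; rewrite horner_opE -(chornerC _ T) -chornerB.
have -> : toC p - (y%:C)%:P = toC (p - y%:P) by rewrite rmorphB/= map_polyC.
set q := p - y%:P => Nq.
have qE x : q.[x] = 0 -> p.[x] = y.
  by rewrite /q !hornerE => /eqP; rewrite subr_eq0 => /eqP.
(* When [p] is the constant [y] there are no roots to choose from: any spectral point works, and one
   exists unless the space is zero, where every operator is invertible. *)
have [q0|q0] := eqVneq q 0.
  have [[x0 x00]|/forallNP H0] := pselect (exists x0 : H, x0 != 0); last first.
    exfalso; apply: Nq; exists 1.
    by split; apply/bop_eqP => x; rewrite (_ : x = 0) ?linear0//; apply/eqP/negPn/negP.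
  have [M TM _] := max_spectrum sT x00; exists M => //; apply: qE.
  by rewrite q0 horner0.
have [rs qrs] := closed_field_poly_normal (toC q).
have lc0 : lead_coef (toC q) != 0 by rewrite lead_coef_eq0 map_poly_eq0.
have [[z zrs Tz]|] := pselect (exists2 z, z \in rs & spectrum T z).
  have zE := spectrum_real sT Tz; exists (complex.Re z); first by rewrite -zE.
  apply: qE; apply: (@complexI R); rewrite -horner_map/= -zE [X in X.[_]]qrs hornerZ.
  suff /rootP -> : root (\prod_(z <- rs) ('X - z%:P)) z by rewrite mulr0.
  by rewrite root_prod_XsubC.
move=> rsT; exfalso; apply: Nq; rewrite qrs chornerZ; apply: invopZ => //.
apply: invop_chorner_prod => z zrs; apply: contrapT => Tz; apply: rsT.
by exists z.
Qed.

Lemma horner_op_rnorm_le p T (c : R) : 0 <= c -> symop T ->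
  (forall x : R, spectrum T x%:C -> `|p.[x]| <= c) -> rnorm (horner_op p T) <= c.
Proof.
move=> c0 sT pc; apply: spectrum_rnorm_le => //; first exact: symop_horner_op.
by move=> y /(spectrum_horner_op sT)[x Tx <-]; exact: pc.
Qed.

End HornerOp.

(** * Uniform approximation by Bernstein polynomials *)

Section Weierstrass.
Variable R : realType.
Implicit Types (f g : R -> R) (a b x e d : R).

Lemma within_continuous_epsdel (A : set R) f x e :
  {within A, continuous f} -> A x -> 0 < e ->
  exists2 d, 0 < d & forall y, A y -> `|x - y| < d -> `|f x - f y| < e.
Proof.
move=> /subspace_continuousP /(_ x) fc Ax e0.
have /cvgrPdist_lt /(_ _ e0) := fc Ax; rewrite near_withinE => /nbhs_ballP[d /= d0 dP].
by exists d => // y Ay xy; apply: dP.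
Qed.

Lemma heine a b f e : {within `[a, b], continuous f} -> 0 < e ->
  exists2 d, 0 < d & forall x y, x \in `[a, b] -> y \in `[a, b] ->
    `|x - y| < d -> `|f x - f y| <= e.
Proof.
move=> fc e0.
(* Compactness in covering form: continuity at each point yields a neighbourhood and a threshold on
   [n], and a single [n] then serves the whole segment. *)
have /compact_near_coveringP cab := @segment_compact R a b.
have := @cab nat (\oo) (fun n x => x \in `[a, b] -> forall y, y \in `[a, b] ->
   `|x - y| < n.+1%:R^-1 -> `|f x - f y| <= e) _.
case.
  move=> x xab; have e20 : 0 < e / 2 by rewrite divr_gt0.
  have [d d0 dP] := within_continuous_epsdel fc xab e20.
  have d20 : 0 < d / 2 by rewrite divr_gt0.
  exists (ball x (d / 2), [set n : nat | n.+1%:R^-1 < d / 2]).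
    split; first exact: nbhsx_ballx.
    exact: (@near_infty_natSinv_lt R (PosNum d20)).
  move=> [x' n] /= [xx' nd] x'ab y yab x'y.
  rewrite -(subrKA (f x)) (le_trans (ler_normD _ _))// (splitr e) lerD//.
    rewrite distrC ltW// dP// (lt_trans xx')// ltr_pdivrMr// ltr_pMr// ltr1n.
    by [].
  rewrite ltW// dP// -(subrKA x') (le_lt_trans (ler_normD _ _))// (splitr d) ltrD//.
  exact: lt_trans nd.
move=> N _ NP; exists N.+1%:R^-1; first by rewrite invr_gt0.
by move=> x y xab yab xy; exact: (NP N (leqnn N) x xab xab y).
Qed.

(** The Bernstein basis: binomial probabilities of parameter [x], whose mean and variance drive the
    approximation. *)
Definition bern (n k : nat) x := 'C(n, k)%:R * (x ^+ k * (1 - x) ^+ (n - k)).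

Lemma bern_sum n x : \sum_(k < n.+1) bern n k x = 1.
Proof.
have := exprDn (1 - x) x n; rewrite subrK expr1n => ->.
by apply: eq_bigr => k _; rewrite /bern mulr_natl [x ^+ k * _]mulrC.
Qed.

(** The identity [k C(n+1, k) = (n+1) C(n, k-1)] removes a factor [k] and lowers the degree.
    Constant [h] yields the mean, and [h k = k] the second moment. *)
Lemma bern_sum_shift n x (h : nat -> R) :
  \sum_(k < n.+2) k%:R * h k * bern n.+1 k x =
  n.+1%:R * x * \sum_(k < n.+1) h k.+1 * bern n k x.
Proof.
rewrite big_ord_recl !mul0r add0r mulr_sumr; apply: eq_bigr => k _.
have -> : lift ord0 k = k.+1 :> nat by []; rewrite /bern subSS exprS.
have -> : n.+1%:R * x * (h k.+1 * ('C(n, k)%:R * (x ^+ k * (1 - x) ^+ (n - k)))) =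
   (n.+1%:R * 'C(n, k)%:R) * (x * (h k.+1 * (x ^+ k * (1 - x) ^+ (n - k)))) by ring.
rewrite -natrM (mul_bin_diag n.+1 k) natrM; ring.
Qed.

Lemma bern_mean n x : \sum_(k < n.+1) k%:R * bern n k x = n%:R * x.
Proof.
case: n => [|n]; first by rewrite big_ord1 !mul0r.
have := bern_sum_shift n x (fun=> 1).
under eq_bigr do rewrite mulr1.
by under [X in _ * X]eq_bigr do rewrite mul1r; rewrite bern_sum mulr1.
Qed.

Lemma bern_var n x :
  \sum_(k < n.+2) (k%:R - n.+1%:R * x) ^+ 2 * bern n.+1 k x = n.+1%:R * (x * (1 - x)).
Proof.
transitivity (\sum_(k < n.+2) k%:R * k%:R * bern n.+1 k x
  - 2 * n.+1%:R * x * (\sum_(k < n.+2) k%:R * bern n.+1 k x)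
  + (n.+1%:R * x) ^+ 2 * \sum_(k < n.+2) bern n.+1 k x).
  rewrite !mulr_sumr -sumrB -big_split/=; apply: eq_bigr => k _; ring.
rewrite (bern_sum_shift n x (fun k => k%:R)) bern_mean bern_sum.
under eq_bigr do rewrite -natr1 mulrDl mul1r.
rewrite big_split/= bern_mean bern_sum -natr1; ring.
Qed.

Lemma bern_ge0 n k x : 0 <= x <= 1 -> 0 <= bern n k x.
Proof.
by move=> /andP[x0 x1]; rewrite !mulr_ge0 ?exprn_ge0 ?ler0n ?subr_ge0.
Qed.

(** Grid points within [d] of [x] contribute at most [e]. At the others the difference is at most
    [2 M], and Chebyshev's inequality with the variance [N x (1 - x)] bounds their total weight by
    [1 / (d^2 N)], where [N = n + 1]. *)
Lemma bernstein_approx g (M e d : R) n x : 0 < d -> 0 <= e ->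
  (forall s, 0 <= s <= 1 -> `|g s| <= M) ->
  (forall s t, 0 <= s <= 1 -> 0 <= t <= 1 -> `|s - t| < d -> `|g s - g t| <= e) ->
  0 <= x <= 1 ->
  `|\sum_(k < n.+2) g (k%:R / n.+1%:R) * bern n.+1 k x - g x| <=
     e + 2 * M / (d ^+ 2 * n.+1%:R).
Proof.
move=> d0 e0 gM gd x01; pose N : R := n.+1%:R.
have N0 : 0 < N by rewrite ltr0n.
have M0 : 0 <= M by rewrite (le_trans _ (gM x x01)).
have dN k : (k < n.+2)%N -> 0 <= k%:R / N <= 1.
  by move=> kn; rewrite divr_ge0 ?ler0n//= ler_pdivrMr// mul1r ler_nat.
have -> : g x = \sum_(k < n.+2) g x * bern n.+1 k x by rewrite -mulr_sumr bern_sum mulr1.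
rewrite -sumrB.
rewrite (le_trans (ler_norm_sum _ _ _))//.
apply: (@le_trans _ _ (\sum_(k < n.+2)
    (e + 2 * M / (d ^+ 2 * N ^+ 2) * (k%:R - N * x) ^+ 2) * bern n.+1 k x)).
  apply: ler_sum => k _; rewrite -mulrBl normrM (ger0_norm (bern_ge0 _ _ x01)).
  apply: ler_wpM2r; first exact: bern_ge0.
  have c0 : 0 <= 2 * M / (d ^+ 2 * N ^+ 2) * (k%:R - N * x) ^+ 2.
    by apply: mulr_ge0; [apply: divr_ge0; apply: mulr_ge0; rewrite // sqr_ge0|exact: sqr_ge0].
  have kx := dN k (ltn_ord k).
  have [kd|kd] := ltP (`|k%:R / N - x|) d.
    by apply: (le_trans (gd _ _ kx x01 kd)); rewrite lerDl.
  rewrite (le_trans (ler_normB _ _))//.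
  apply: (@le_trans _ _ (2 * M)).
    by have := gM _ kx; have := gM _ x01; lra.
  suff : 1 <= (k%:R - N * x) ^+ 2 / (d ^+ 2 * N ^+ 2).
    move=> h; have : 2 * M * 1 <= 2 * M * ((k%:R - N * x) ^+ 2 / (d ^+ 2 * N ^+ 2)).
      by apply: ler_wpM2l => //; rewrite mulr_ge0.
    rewrite mulr1 => /le_trans; apply.
    by rewrite -[leLHS]add0r lerD// mulrA mulrAC.
  rewrite ler_pdivlMr ?mulr_gt0 ?exprn_gt0// mul1r.
  have -> : k%:R - N * x = (k%:R / N - x) * N by field; rewrite gt_eqF.
  rewrite exprMn ler_wpM2r ?sqr_ge0// -[leRHS]real_normK ?num_real//.
  by rewrite ler_sqr ?nnegrE// ltW.
under eq_bigr do rewrite mulrDl -mulrA.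
rewrite big_split/= -!mulr_sumr bern_sum bern_var mulr1 lerD2l -/N.
have -> : 2 * M / (d ^+ 2 * N ^+ 2) * (N * (x * (1 - x))) =
   2 * M / (d ^+ 2 * N) * (x * (1 - x)) by field; rewrite !gt_eqF.
rewrite ler_piMr//.
  by apply: divr_ge0; apply: mulr_ge0; rewrite // ?sqr_ge0// ltW.
by case/andP: x01 => x0 x1; nra.
Qed.

(** Rescale [f] to [g] on [[0, 1]], where Heine-Cantor gives uniform continuity and the extreme
    values give the bound [M]; the polynomial is the Bernstein polynomial of [g] composed with the
    affine map [L] from [[a, b]] to [[0, 1]]. *)
Lemma weierstrass a b f e : {within `[a, b], continuous f} -> 0 < e ->
  exists p : {poly R}, forall x, a <= x <= b -> `|p.[x] - f x| <= e.
Proof.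
move=> fc e0; have [ab|] := ltP a b; last first.
  move=> ba; exists (f a)%:P => x /andP[ax xb].
  have -> : x = a by apply/eqP; rewrite eq_le ax (le_trans xb ba).
  by rewrite hornerC subrr normr0 ltW.
have ba0 : 0 < b - a by rewrite subr_gt0.
have e20 : 0 < e / 2 by rewrite divr_gt0.
have [d d0 dP] := heine fc e20.
have [c1 _ c1P] := EVT_max (ltW ab) fc.
have [c2 _ c2P] := EVT_min (ltW ab) fc.
pose g s := f (a + s * (b - a)).
have inab s : 0 <= s <= 1 -> a + s * (b - a) \in `[a, b].
  move=> /andP[s0 s1]; rewrite in_itv/=; apply/andP; split; nra.
pose M := `|f c1| + `|f c2|.
have gM s : 0 <= s <= 1 -> `|g s| <= M.
  move=> /inab s01; rewrite ler_norml /M; have := c1P _ s01; have := c2P _ s01.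
  have := ler_norm (f c1); have := ler_normr (- f c2) (f c2).
  have := lerNnormlW (lexx `|f c2|); have := normr_ge0 (f c1); have := normr_ge0 (f c2).
  by rewrite /g => *; apply/andP; split; lra.
have gd s t : 0 <= s <= 1 -> 0 <= t <= 1 -> `|s - t| < d / (b - a) -> `|g s - g t| <= e / 2.
  move=> s01 t01 st; apply: dP; [exact: inab|exact: inab|].
  have -> : a + s * (b - a) - (a + t * (b - a)) = (s - t) * (b - a) by ring.
  by rewrite normrM (gtr0_norm ba0) -ltr_pdivlMr.
have M0 : 0 <= M by rewrite addr_ge0.
pose D := d / (b - a); have D0 : 0 < D by rewrite divr_gt0.
have [n nP] : exists n, 2 * M / (D ^+ 2 * n.+1%:R) <= e / 2.
  (* An integer above [2 M / (D^2 (e / 2))] makes the Chebyshev term at most [e / 2]; the degree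
     [n.+1] is this [N]. *)
  set N := (Num.truncn (2 * M / (D ^+ 2 * (e / 2)))).+1; exists N.-1.
  have := truncnS_gt (2 * M / (D ^+ 2 * (e / 2))).
  have D20 : 0 < D ^+ 2 by rewrite exprn_gt0.
  rewrite (ltr_pdivrMr _ _ (mulr_gt0 D20 e20)) => /ltW h.
  rewrite ler_pdivrMr; last by rewrite (mulr_gt0 D20).
  rewrite -[N.-1.+1]/N.
  by have -> : e / 2 * (D ^+ 2 * N%:R) = N%:R * (D ^+ 2 * (e / 2)) by ring.
pose L : {poly R} := (b - a)^-1 *: ('X - a%:P).
exists (\sum_(k < n.+2) (g (k%:R / n.+1%:R) * 'C(n.+1, k)%:R) *: (L ^+ k * (1 - L) ^+ (n.+1 - k))).
move=> x /andP[ax xb]; pose s := (x - a) / (b - a).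
have s01 : 0 <= s <= 1.
  by rewrite divr_ge0 ?subr_ge0 ?(ltW ab)//= ler_pdivrMr// mul1r lerD2r.
have -> : f x = g s by rewrite /g /s divfK ?gt_eqF// addrC subrK.
have Lx : L.[x] = s by rewrite /L !hornerE mulrC.
have := bernstein_approx n D0 (ltW e20) gM gd s01.
rewrite horner_sum => /le_trans h.
under eq_bigr do rewrite hornerZ hornerM !horner_exp hornerD hornerN hornerC Lx -mulrA -/(bern _ _ _).
by apply: h; rewrite [leRHS]splitr lerD.
Qed.

End Weierstrass.

(** * The continuous functional calculus of a symmetric operator *)

Lemma uniform_cvg_epsP (R : realType) (A : set R) (u : nat -> R -> R) (f : R -> R) :
  {uniform A, u @ \oo --> f} <->
  forall e : R, 0 < e -> exists N, forall n, (N <= n)%N -> forall x, A x -> `|u n x - f x| <= e.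
Proof.
split=> [uf e e0|uf P].
  have : nbhs (f : {uniform` A -> R}) [set h : {uniform` A -> R} | forall y, A y -> ball (f y) e (h y)].
    apply/uniform_nbhs; exists [set xy | ball xy.1 e xy.2]; split=> //.
    exact: entourage_ball (PosNum e0).
  move=> /uf [N _ NP]; exists N => n Nn x Ax; rewrite distrC ltW//.
  exact: (NP n Nn x Ax).
move=> /uniform_nbhs [E [+ EP]]; rewrite -entourage_ballE => -[e /= e0 eE].
have e20 : 0 < e / 2 by rewrite divr_gt0.
have [N NP] := uf _ e20; exists N => // n /= Nn.
apply: EP => y Ay /=; apply: eE => /=; rewrite /ball/= distrC (le_lt_trans (NP _ Nn _ Ay))//.
by rewrite ltr_pdivrMr// ltr_pMr// ltr1n.
Qed.

(** Subtracting the symmetric [u N] from [v] leaves the defect [<v x, y> - <x, v y>] unchanged, so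
    the defect is arbitrarily small. *)
Lemma cvg_symop (R : realType) (H : hilbertType R) (u : nat -> bop H) (v : bop H) :
  (forall n, symop (u n)) -> u @ \oo --> v -> symop v.
Proof.
move=> su /cvg_rnormP uv x y; apply/eqP; rewrite -subr_eq0 -normr_eq0 eq_le normr_ge0 andbT.
apply/ler_addgt0Pr => e e0; rewrite add0r.
pose c := rnorm x * rnorm y + 1.
have c0 : 0 < c by rewrite ltr_wpDl// mulr_ge0 ?rnorm_ge0.
have ec0 : 0 < e / 2 / c by rewrite !divr_gt0.
have [N /(_ N (leqnn N)) h] := uv _ ec0.
have -> : rdot (v x) y - rdot x (v y) = rdot ((v - u N) x) y - rdot x ((v - u N) y).
  by rewrite !bopBE !rdotE su; ring.
have hb x' y' : rnorm x' * rnorm y' <= c -> `|rdot ((v - u N) x') y'| <= e / 2.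
  move=> xyc; rewrite (le_trans (rdot_bop_le _ _ _))//.
  have -> : e / 2 = e / 2 / c * c by rewrite divfK ?gt_eqF.
  by rewrite ler_pM ?rnorm_ge0 ?mulr_ge0 ?rnorm_ge0.
rewrite (le_trans (ler_normB _ _))// (splitr e) lerD//.
  by apply: hb; rewrite /c lerDl.
by rewrite rdotC; apply: hb; rewrite /c mulrC lerDl.
Qed.

Section CfcSpec.
Variables (R : realType) (H : hilbertType R) (T : bop H) (a b : R) (f : R -> R).
Hypotheses (sT : symop T) (fc : {within `[a, b], continuous f})
  (Tab : forall x : R, spectrum T x%:C -> a <= x <= b).

(** Rules out the default value in [cfc]: Weierstrass polynomials on [[a, b]] converge uniformly on
    the spectrum, and the norm bound makes their values at [T] a Cauchy sequence. *)
Lemma cfc_lim : exists2 p : nat -> {poly R},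
  forall e : R, 0 < e -> exists N, forall n, (N <= n)%N ->
    forall x, spectrum T x%:C -> `|(p n).[x] - f x| <= e &
  horner_op (p n) T @[n --> \oo] --> cfc f T.
Proof.
suff : [set S | exists2 p : nat -> {poly R},
    {uniform [set x : R | spectrum T x%:C],
       (fun n x => (p n).[x]) @ \oo --> f} &
    horner_op (p n) T @[n --> \oo] --> S] (cfc f T).
  by case=> p /uniform_cvg_epsP pf pT; exists p.
have /choice[p pP] (n : nat) : exists p : {poly R}, forall x, a <= x <= b -> `|p.[x] - f x| <= n.+1%:R^-1.
  by apply: weierstrass; rewrite ?invr_gt0.
have pe (e : R) : 0 < e -> exists N, forall n, (N <= n)%N ->
    forall x, spectrum T x%:C -> `|(p n).[x] - f x| <= e.
  move=> e0; have [N _ NP] := @near_infty_natSinv_lt R (PosNum e0).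
  exists N => n Nn x /Tab xab; rewrite (le_trans (pP _ _ xab))// ltW//.
  exact: (NP n Nn).
apply: (@xgetPex _ (0 : bop H)).
suff /cvg_ex[S pS] : cvg (horner_op (p n) T @[n --> \oo]).
  by exists S, p => //; apply/uniform_cvg_epsP.
apply: rnorm_cauchy_cvg => e e0; have e20 : 0 < e / 2 by rewrite divr_gt0.
have [N NP] := pe _ e20; exists N => m n Nm Nn.
rewrite -horner_opB; apply: horner_op_rnorm_le => // [|x Tx]; first exact: ltW.
rewrite hornerD hornerN -(subrKA (f x)) (le_trans (ler_normD _ _))// (splitr e).
by rewrite lerD ?NP// distrC NP.
Qed.

Lemma symop_cfc : symop (cfc f T).
Proof.
by have [p _ /cvg_symop] := cfc_lim; apply => n; exact: symop_horner_op.
Qed.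

(** Compare [p] on the spectrum with the polynomials that define [cfc f T], whichever they are, and
    pass to the limit in the norm bound. *)
Lemma cfc_horner_op_le (p : {poly R}) (e : R) : 0 <= e ->
  (forall x : R, spectrum T x%:C -> `|p.[x] - f x| <= e) ->
  rnorm (horner_op p T - cfc f T) <= e.
Proof.
move=> e0 pf; have [q qf qT] := cfc_lim; apply/ler_addgt0Pr => d d0.
apply: (cvg_rnorm_le qT); have [N NP] := qf _ d0; exists N => n Nn.
rewrite -horner_opB; apply: horner_op_rnorm_le => // [|x Tx]; first by rewrite addr_ge0// ltW.
rewrite hornerD hornerN -(subrKA (f x)) (le_trans (ler_normD _ _))//.
by rewrite lerD ?pf// distrC NP.
Qed.

End CfcSpec.

(** * The operator segment from [A] to [B] and the functional calculus along it *)

Section NablaPath.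
Variables (R : realType) (H : hilbertType R) (I : set R) (A B : bop H).
Hypotheses (I_neq0 : I !=set0) (I_itv : is_interval I).
Hypotheses (IA : selfadjoint_in I A) (IB : selfadjoint_in I B).

Lemma symop_nabla t : symop (nabla t A B).
Proof.
by apply: symopD; apply: symopZ; apply/selfadjointP; [case: IA|case: IB].
Qed.

(** Bounds on the form survive convex combinations. The smaller of the two lower endpoints for [A]
    and [B], and the larger of the upper ones, still belong to [I]. *)
Lemma nabla_numrange : exists a b, [/\ I a, I b & forall (t : R) (x : H), 0 <= t <= 1 ->
  a * rnorm x ^+ 2 <= rdot (nabla t A B x) x <= b * rnorm x ^+ 2].
Proof.
have [a1 [b1 [Ia1 Ib1 h1]]] := numrange_in_itv I_neq0 IA.
have [a2 [b2 [Ia2 Ib2 h2]]] := numrange_in_itv I_neq0 IB.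
exists (Num.min a1 a2), (Num.max b1 b2); split.
- by rewrite minEle; case: ifP.
- by rewrite maxEle; case: ifP.
move=> t x /andP[t0 t1]; have t1' : 0 <= 1 - t by rewrite subr_ge0.
rewrite /nabla bopDE !bopZE !rdotE.
have N0 := rnorm_sqr_ge0 x; have /andP[l1 u1] := h1 x; have /andP[l2 u2] := h2 x.
have m1 : Num.min a1 a2 <= a1 by rewrite ge_min lexx.
have m2 : Num.min a1 a2 <= a2 by rewrite ge_min lexx orbT.
have M1 : b1 <= Num.max b1 b2 by rewrite le_max lexx.
have M2 : b2 <= Num.max b1 b2 by rewrite le_max lexx orbT.
have split_conv c : c * rnorm x ^+ 2 = (1 - t) * (c * rnorm x ^+ 2) + t * (c * rnorm x ^+ 2) by ring.
rewrite [leLHS]split_conv [X in _ && (_ <= X)]split_conv; apply/andP; split.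
  by rewrite lerD// ler_wpM2l//; [apply: le_trans l1|apply: le_trans l2]; rewrite ler_wpM2r.
by rewrite lerD// ler_wpM2l//; [apply: (le_trans u1)|apply: (le_trans u2)]; rewrite ler_wpM2r.
Qed.

Lemma nabla_spectrum : exists a b, [/\ I a, I b & forall t x : R, 0 <= t <= 1 ->
  spectrum (nabla t A B) x%:C -> a <= x <= b].
Proof.
have [a [b [Ia Ib ab]]] := nabla_numrange; exists a, b; split=> // t x t01 tx.
apply/andP; split.
  by apply: (spectrum_ge (symop_nabla t)) tx => y; have /andP[] := ab t y t01.
by apply: (spectrum_le (symop_nabla t)) tx => y; have /andP[] := ab t y t01.
Qed.

Lemma selfadjoint_in_nabla t : 0 <= t <= 1 -> selfadjoint_in I (nabla t A B).
Proof.
move=> t01; split; first by apply/selfadjointP; exact: symop_nabla.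
have [a [b [Ia Ib ab]]] := nabla_spectrum.
move=> z tz; have zE := spectrum_real (symop_nabla t) tz; exists (complex.Re z) => //.
by apply: (I_itv Ia Ib); apply: (ab t) => //; rewrite -zE.
Qed.

(** Turns operator convexity at two points of the path into convexity in the parameter. *)
Lemma nabla_nabla s t u :
  nabla s (nabla t A B) (nabla u A B) = nabla ((1 - s) * t + s * u) A B.
Proof.
rewrite /nabla !scalerDr !scalerA -!rmorphM addrACA -!scalerDl -!rmorphD/=.
by congr (_%:C *: _ + _%:C *: _); ring.
Qed.

(** Boundedness is included with the Lipschitz condition so that the class is closed under
    products. *)
Definition lip01 (G : R -> bop H) := exists L : R, forall s t : R, 0 <= s <= 1 -> 0 <= t <= 1 ->
  rnorm (G s) <= L /\ rnorm (G s - G t) <= L * `|s - t|.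

Lemma lip01_cst (T : bop H) : lip01 (fun=> T).
Proof.
exists (rnorm T) => s t _ _; split=> //; rewrite subrr rnorm0 mulr_ge0//.
exact: rnorm_ge0.
Qed.

Lemma lip01D G1 G2 : lip01 G1 -> lip01 G2 -> lip01 (fun t => G1 t + G2 t).
Proof.
move=> [L1 h1] [L2 h2]; exists (L1 + L2) => s t s01 t01.
have [b1 l1] := h1 s t s01 t01; have [b2 l2] := h2 s t s01 t01; split.
  by rewrite (le_trans (rnormD _ _))// lerD.
by rewrite opprD addrACA (le_trans (rnormD _ _))// mulrDl lerD.
Qed.

Lemma lip01M G1 G2 : lip01 G1 -> lip01 G2 -> lip01 (fun t => G1 t * G2 t).
Proof.
move=> [L1 h1] [L2 h2]; exists (L1 * L2 + L1 * L2) => s t s01 t01.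
have [b1 l1] := h1 s t s01 t01; have [b2 l2] := h2 s t s01 t01.
have [b3 _] := h2 t s t01 s01.
have L10 : 0 <= L1 := le_trans (rnorm_ge0 _) b1.
have L20 : 0 <= L2 := le_trans (rnorm_ge0 _) b2.
split.
  rewrite (le_trans (rnormM_le _ _))// (@le_trans _ _ (L1 * L2))//.
    by rewrite ler_pM ?rnorm_ge0.
  by rewrite lerDl mulr_ge0.
rewrite (le_trans (rnormB_trans (G1 s * G2 t) _ _))// -mulrBr -mulrBl [leRHS]mulrDl lerD//.
  by rewrite (le_trans (rnormM_le _ _))// -mulrA ler_pM ?rnorm_ge0.
by rewrite (le_trans (rnormM_le _ _))// mulrAC ler_pM ?rnorm_ge0.
Qed.

Lemma lip01_scal (T : bop H) : lip01 (fun t => t%:C *: T).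
Proof.
exists (rnorm T) => s t s01 t01; split.
  rewrite rnormZR ler_piMl ?rnorm_ge0// ger0_norm; by case/andP: s01.
by rewrite -scalerBl -rmorphB rnormZR mulrC.
Qed.

Lemma lip01_nabla : lip01 (fun t => nabla t A B).
Proof.
have -> : (fun t => nabla t A B) = (fun t => A + t%:C *: (B - A)).
  apply/funext => t; rewrite /nabla rmorphB rmorph1 scalerBl scale1r scalerBr.
  by rewrite addrAC addrA.
by apply: lip01D; [exact: lip01_cst|exact: lip01_scal].
Qed.

Lemma lip01_horner_op (p : {poly R}) : lip01 (fun t => horner_op p (nabla t A B)).
Proof.
have lX i : lip01 (fun t => nabla t A B ^+ i).
  elim: i => [|i IH]; first exact: lip01_cst.
  have -> : (fun t => nabla t A B ^+ i.+1) = (fun t => nabla t A B * nabla t A B ^+ i).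
    by apply/funext => t; rewrite exprS.
  by apply: lip01M => //; exact: lip01_nabla.
rewrite /horner_op; elim: (index_enum _) => [|i s IH].
  have -> : (fun t : R => \sum_(j <- [::]) (p`_(j : 'I_(size p)))%:C *: nabla t A B ^+ j) = (fun=> 0 : bop H).
    by apply/funext => t; rewrite big_nil.
  exact: lip01_cst.
have -> : (fun t : R => \sum_(j <- i :: s) (p`_j)%:C *: nabla t A B ^+ j) =
   (fun t => ((p`_i)%:C *: (1 : bop H)) * nabla t A B ^+ i + \sum_(j <- s) (p`_j)%:C *: nabla t A B ^+ j).
  by apply/funext => t; rewrite big_cons bop_scalerAl mul1r.
by apply: lip01D => //; apply: lip01M => //; exact: lip01_cst.
Qed.

Variables (f : R -> R).
Hypothesis f_cont : {within I, continuous f}.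

Lemma symop_cfc_nabla t : 0 <= t <= 1 -> symop (cfc f (nabla t A B)).
Proof.
have [a [b [Ia Ib ab]]] := nabla_spectrum; move=> t01.
apply: (@symop_cfc _ _ _ a b) => [||x]; first exact: symop_nabla.
  by apply: continuous_subspaceW f_cont => x /=; rewrite in_itv; exact: I_itv.
exact: ab.
Qed.

(** A polynomial [p] within [e / 3] of [f] on a segment containing all the spectra costs [e / 3] at
    each end; in between, the path of [p] is Lipschitz with constant [L]. Dividing by [L + 1] allows
    [L = 0]. *)
Lemma cfc_nabla_unif (e : R) : 0 < e -> exists2 d : R, 0 < d &
  forall s t : R, 0 <= s <= 1 -> 0 <= t <= 1 -> `|s - t| < d ->
    rnorm (cfc f (nabla s A B) - cfc f (nabla t A B)) <= e.
Proof.
have [a [b [Ia Ib ab]]] := nabla_spectrum; move=> e0.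
have fab : {within `[a, b], continuous f}.
  by apply: continuous_subspaceW f_cont => x /=; rewrite in_itv; exact: I_itv.
have e30 : 0 < e / 3 by rewrite divr_gt0.
have [p pf] := weierstrass fab e30.
have [L LP] := lip01_horner_op p.
have L0 : 0 <= L.
  have z01 : 0 <= (0 : R) <= 1 by rewrite lexx ler01.
  by have [+ _] := LP 0 0 z01 z01; apply: le_trans; exact: rnorm_ge0.
have pT t : 0 <= t <= 1 -> rnorm (horner_op p (nabla t A B) - cfc f (nabla t A B)) <= e / 3.
  move=> t01; apply: (@cfc_horner_op_le _ _ _ a b) => //.
  - exact: symop_nabla.
  - by move=> x; exact: ab.
  - exact: ltW.
  - by move=> x tx; apply: pf; exact: ab tx.
have L10 : 0 < L + 1 by rewrite ltr_wpDl.
exists (e / 3 / (L + 1)); first by rewrite divr_gt0.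
move=> s t s01 t01 st.
apply: (le_trans (rnormB_trans (horner_op p (nabla s A B)) _ _)).
have -> : e = e / 3 + (e / 3 + e / 3) by field.
apply: lerD; first by rewrite rnormBC pT.
apply: (le_trans (rnormB_trans (horner_op p (nabla t A B)) _ _)).
apply: lerD; last exact: pT.
have [_ /le_trans] := LP s t s01 t01; apply.
move: st; rewrite ltr_pdivlMr// => /ltW; apply: le_trans.
by rewrite mulrC ler_wpM2l// lerDl.
Qed.

End NablaPath.

(** * Integrability of continuous functions on the unit interval *)

Lemma within_itv_measurable (R : realType) (g : R -> R) :
  {within `[0, 1], continuous g} -> measurable_fun (`[0, 1]%classic : set R) g.
Proof. by move=> gc; exact: subspace_continuous_measurable_fun. Qed.

Lemma within_itv_bounded (R : realType) (g : R -> R) :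
  {within `[0, 1], continuous g} -> [bounded g t | t in (`[0, 1]%classic : set R)].
Proof.
move=> gc; have [c1 _ c1P] := EVT_max ler01 gc; have [c2 _ c2P] := EVT_min ler01 gc.
exists (`|g c1| + `|g c2|); split; first exact: num_real.
move=> M MM x /= x01; apply: (le_trans _ (ltW MM)).
have := c1P _ x01; have := c2P _ x01; rewrite ler_norml.
have := ler_norm (g c1); have := lerNnormlW (lexx `|g c2|).
have := normr_ge0 (g c1); have := normr_ge0 (g c2).
by move=> *; apply/andP; split; lra.
Qed.

Lemma within_itv_integrable (R : realType) (mu : {finite_measure set R -> \bar R})
    (g : R -> R) :
  {within `[0, 1], continuous g} -> mu.-integrable (`[0, 1]%classic : set R) (EFin \o g).
Proof.
move=> gc; apply: measurable_bounded_integrable => //.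
- by rewrite ltey_eq fin_num_measure.
- exact: within_itv_measurable.
- exact: within_itv_bounded.
Qed.

(** * The mean of [eta], and Jensen's and the chord inequality for it *)

Section EtaIntegral.
Context {R : realType}.
Variables (l : R) (l01 : 0 < l < 1).
Local Notation mu := (@lebesgue_measure R).
Local Notation nu := (eta l01).

(* The Lebesgue measure lives on [measurableTypeR R], whose display differs from
   that of the default measurable structure on R, on which [eta] lives. *)
Definition to_leb : R -> measurableTypeR R := idfun.

Lemma measurable_to_leb : measurable_fun [set: R] to_leb.
Proof. by move=> _ Y mY; rewrite setTI. Qed.

HB.instance Definition _ := isMeasurableFun.Build _ _ R (measurableTypeR R)
  to_leb measurable_to_leb.

Definition eta_leb : probability (measurableTypeR R) R := distribution nu to_leb.

Lemma eta_lebE (U : set R) : eta_leb U = (\int[mu]_(t in U) (eta_pdf l t)%:E)%E.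
Proof. by []. Qed.

Lemma eta_leb_dominates : eta_leb `<< mu.
Proof.
apply/null_content_dominatesP => A mA muA0; rewrite eta_lebE; apply: null_set_integral => //.
by apply/measurable_EFinP/measurable_funTS; exact: measurable_eta_pdf.
Qed.

(** The Radon-Nikodym derivative with respect to the Lebesgue measure has the same integral as
    [eta_pdf] over every measurable set, so the two agree almost everywhere. *)
Lemma integral_eta_leb (U : set (measurableTypeR R)) (f : measurableTypeR R -> \bar R) :
  measurable U -> eta_leb.-integrable U f ->
  (\int[eta_leb]_(x in U) f x = \int[mu]_(x in U) (f x * (eta_pdf l x)%:E))%E.
Proof.
move=> mU intf; have mf := measurable_int _ intf.
have mpdf : measurable_fun [set: measurableTypeR R] (EFin \o eta_pdf l).
  by apply/measurable_EFinP; exact: measurable_eta_pdf.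
rewrite -(Radon_Nikodym_change_of_variables eta_leb_dominates)//=.
apply: ae_eq_integral => //.
- apply: emeasurable_funM => //; apply: (measurable_int mu).
  apply: (integrableS _ _ (@subsetT _ _)) => //.
  by apply: Radon_Nikodym_integrable; exact: eta_leb_dominates.
- by apply: emeasurable_funM => //; exact: measurable_funTS.
- apply: ae_eqe_mul2l; rewrite Radon_NikodymE//=; first exact: eta_leb_dominates.
  move=> dom; case: cid => h [h1 h2 h3] /=; apply: integral_ae_eq => //.
  + exact: integrableS h2.
  + exact: measurable_funTS.
  + by move=> E _ mE; rewrite -h3.
Qed.

Lemma integral_eta_pdf_itv (k : R) : 0 < k < 1 ->
  (\int[mu]_(t in `[0%R, 1%R]) (eta_pdf k t)%:E = 1)%E.
Proof.
move=> k01; rewrite -(integral_eta_pdf k01) integral_mkcond.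
apply: eq_integral => t _; rewrite /eta_pdf !patchE.
by case: (t \in _).
Qed.

Lemma eta_itv01 : nu `[0, 1] = 1%E.
Proof. exact: integral_eta_pdf_itv. Qed.

Lemma within_itv_id : {within `[0, 1], continuous (@idfun R)}.
Proof. by apply: continuous_subspaceT => x; exact: cvg_id. Qed.

(* Multiplying the density by t increases the exponent by 1, which gives a
   multiple of the density of parameter 1 / (2 - l). *)
Lemma eta_mean : \int[nu]_(t in `[0, 1]) t = l.
Proof.
case/andP: (l01) => l0 l1.
have d0 : 0 < 1 - l by rewrite subr_gt0.
have d20 : 0 < 2 - l by lra.
pose k := (2 - l)^-1.
have k01 : 0 < k < 1 by rewrite invr_gt0 d20/= invf_lt1//; lra.
have tE : (\int[nu]_(t in `[0%R, 1%R]) t%:E = \int[eta_leb]_(t in `[0%R, 1%R]) t%:E)%E.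
  apply/esym; rewrite /eta_leb /distribution ge0_integral_pushforward//.
  by move=> t; rewrite inE/= in_itv/= => /andP[].
rewrite /Rintegral tE integral_eta_leb//; last first.
  have := @measurable_bounded_integrable _ (measurableTypeR R) R eta_leb idfun `[0, 1]%classic.
  apply => //.
  - by rewrite [X in (X < _)%E]integral_eta_pdf_itv ?ltry.
  - by move=> mD Y mY; exact: measurableI.
  exists 1; split=> // M M1 t /=; rewrite in_itv/= => /andP[t0 t1].
  by rewrite ger0_norm// (le_trans t1)// ltW.
transitivity (fine (\int[mu]_(t in `[0%R, 1%R]) (l%:E * (eta_pdf k t)%:E))%E).
  congr fine; apply: eq_integral => t t01; rewrite -!EFinM; congr EFin.
  rewrite /eta_pdf !patchE t01 /eta_pdfT.
  move: t01; rewrite inE/= in_itv/= => /andP[t0 t1].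
  have -> : (2 * k - 1) / (1 - k) = l / (1 - l).
    by rewrite /k; field; rewrite !gt_eqF//; lra.
  have -> : k / (1 - k) = (1 - l)^-1 by rewrite /k; field; rewrite !gt_eqF//; lra.
  have -> : (2 * l - 1) / (1 - l) = l / (1 - l) - 1 by field; rewrite gt_eqF.
  rewrite mulrCA mulr_powRB1 ?divr_gt0//.
  by rewrite mulrA.
rewrite ge0_integralZl//; last 3 first.
- by apply/measurable_EFinP/measurable_funTS; exact: measurable_eta_pdf.
- by move=> t _; rewrite lee_fin eta_pdf_ge0.
- by rewrite lee_fin ltW.
by rewrite integral_eta_pdf_itv// mule1.
Qed.

Lemma eta_affine (a b : R) : \int[nu]_(t in `[0, 1]) (a + b * t) = a + b * l.
Proof.
rewrite RintegralD//; last 2 first.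
- by apply: within_itv_integrable; apply: continuous_subspaceT => x; exact: cvg_cst.
- apply: within_itv_integrable; apply: continuous_subspaceT => x.
  by apply: cvgMr; exact: cvg_id.
rewrite RintegralZl//; last exact: (within_itv_integrable nu within_itv_id).
by rewrite eta_mean Rintegral_cst// [X in fine X]eta_itv01 mulr1.
Qed.

Lemma within_itv_affine (a b : R) : {within `[0, 1], continuous (fun t => a + b * t)}.
Proof.
apply: continuous_subspaceT => x; apply: cvgD; first exact: cvg_cst.
by apply: cvgMr; exact: cvg_id.
Qed.

Variable g : R -> R.
Hypothesis g_cont : {within `[0, 1], continuous g}.
Hypothesis g_conv : forall s t u : R, 0 <= s <= 1 -> 0 <= t <= 1 -> 0 <= u <= 1 ->
  g ((1 - s) * t + s * u) <= (1 - s) * g t + s * g u.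

(** Integrate the chord of [g] over [[0, 1]]; an affine function integrates to its value at the mean
    [l]. *)
Lemma eta_jensen_le : \int[nu]_(t in `[0, 1]) g t <= (1 - l) * g 0 + l * g 1.
Proof.
have -> : (1 - l) * g 0 + l * g 1 = g 0 + (g 1 - g 0) * l by ring.
rewrite -eta_affine; apply: le_Rintegral => //.
- exact: within_itv_integrable.
- by apply: within_itv_integrable; exact: within_itv_affine.
- move=> t /=; rewrite in_itv/= => t01.
  have := g_conv t01 (t := 0) (u := 1); rewrite lexx ler01 mulr0 mulr1 add0r => h.
  by apply: (le_trans (h _ _)) => //; lra.
Qed.

(** Take for [k] the supremum of the slopes of chords arriving at [l] from the left; by convexity
    each is at most every slope leaving [l] to the right. *)
Lemma convex_support_line : exists k : R, forall t, 0 <= t <= 1 -> g l + k * (t - l) <= g t.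
Proof.
case/andP: (l01) => l0 l1.
have slope (s u : R) : 0 <= s < l -> l < u <= 1 -> (g l - g s) / (l - s) <= (g u - g l) / (u - l).
  move=> /andP[s0 sl] /andP[lu u1].
  rewrite ler_pdivrMr ?subr_gt0// mulrAC ler_pdivlMr ?subr_gt0//.
  have us : 0 < u - s by lra.
  (* The weight that writes [l] as [(1 - r) s + r u]. *)
  pose r := (l - s) / (u - s).
  have r01 : 0 <= r <= 1.
    by rewrite divr_ge0 ?subr_ge0 ?(ltW sl) ?(ltW (lt_trans sl lu))//= ler_pdivrMr// mul1r lerD2r ltW.
  have s01 : 0 <= s <= 1 by rewrite s0 ltW// (lt_trans sl).
  have u01 : 0 <= u <= 1 by rewrite u1 andbT ltW// (lt_trans l0).
  have := g_conv r01 s01 u01.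
  have -> : (1 - r) * s + r * u = l by rewrite /r; field; rewrite gt_eqF.
  rewrite -(ler_pM2l us).
  have -> : (u - s) * ((1 - r) * g s + r * g u) = (u - l) * g s + (l - s) * g u.
    by rewrite /r; field; rewrite gt_eqF.
  nra.
pose S := [set (g l - g s) / (l - s) | s in [set s | 0 <= s < l]].
have S0 : S !=set0 by exists ((g l - g 0) / (l - 0)), 0 => //; apply/andP.
have Sub u : l < u <= 1 -> ubound S ((g u - g l) / (u - l)).
  by move=> lu _ [s /= sl <-]; exact: slope.
have l1' : l < (1 : R) <= 1 by rewrite l1 lexx.
exists (sup S) => t /andP[t0 t1].
have [tl|lt|->] := ltgtP t l.
- have : (g l - g t) / (l - t) <= sup S.
    apply: sup_upper_bound; first by split=> //; exists ((g 1 - g l) / (1 - l)); exact: (Sub _ l1').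
    by exists t => //=; rewrite t0.
  by rewrite ler_pdivrMr ?subr_gt0//; nra.
- have : sup S <= (g t - g l) / (t - l) by apply: ge_sup => //; apply: Sub; rewrite lt.
  by rewrite ler_pdivlMr ?subr_gt0//; nra.
- by rewrite subrr mulr0 addr0.
Qed.

Lemma eta_jensen_ge : g l <= \int[nu]_(t in `[0, 1]) g t.
Proof.
have [k kP] := convex_support_line.
have -> : g l = \int[nu]_(t in `[0, 1]) ((g l - k * l) + k * t).
  by rewrite eta_affine; ring.
apply: le_Rintegral => //.
- by apply: within_itv_integrable; exact: within_itv_affine.
- exact: within_itv_integrable.
- by move=> t /=; rewrite in_itv/= => /kP; lra.
Qed.

End EtaIntegral.

(** * Monotonicity of the lower integral *)

Section LowerIntegral.
Context d (T : measurableType d) (R : realType).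
Variables (mu : {measure set T -> \bar R}) (D : set T).
Local Open Scope ereal_scope.

(* No measurability: the integral of a nonnegative function is a lower integral. *)
Lemma ge0_le_lower_integral (f g : T -> \bar R) :
  (forall x, D x -> 0 <= f x) -> (forall x, D x -> f x <= g x) ->
  \int[mu]_(x in D) f x <= \int[mu]_(x in D) g x.
Proof.
move=> f0 fg; have g0 x : D x -> 0 <= g x.
  by move=> Dx; rewrite (le_trans (f0 x Dx))// fg.
rewrite !ge0_integralE//; apply: ereal_sup_le => _ [h hf <-]; exists h => // x.
apply: (le_trans (hf x)); rewrite !patchE; case: ifPn => //.
by rewrite inE; exact: fg.
Qed.

End LowerIntegral.

(** * Bounded real-linear functionals commute with the Bochner integral *)

Section BochnerFunctional.
Context d (T : measurableType d) (R : realType).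
Variables (V : completeNormedModType R[i]) (mu : {finite_measure set T -> \bar R}).
Variables (D : set T) (mD : measurable D).
Variables (phi : V -> R) (C : R).
Hypotheses (phiD : forall x y, phi (x + y) = phi x + phi y)
  (phiZ : forall (r : R) x, phi (r%:C *: x) = r * phi x)
  (phiC : forall x, `|phi x| <= C * rnorm x).

Let phi0 : phi 0 = 0.
Proof. by rewrite -(scale0r 0) -[X in X *: _]/(0%:C) phiZ mul0r. Qed.

Let phiB x y : phi (x - y) = phi x - phi y.
Proof.
have -> : - y = (-1)%:C *: y by rewrite rmorphN1 scaleN1r.
by rewrite phiD phiZ mulN1r.
Qed.

Let phi_sum (J : Type) (s : seq J) (F : J -> V) :
  phi (\sum_(j <- s) F j) = \sum_(j <- s) phi (F j).
Proof. by elim/big_rec2 : _ => [|j x y _ <-]; [exact: phi0|rewrite phiD]. Qed.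

Lemma simple_functionalE (s : {fimfun T >-> V}) t :
  phi (s t) = \sum_(y <- finmap.enum_fset (fset_set (range s))) phi y * \1_(s @^-1` [set y]) t.
Proof.
rewrite -(fsbig_finite _ (fun y => phi y * \1_(s @^-1` [set y]) t))// (fsbigD1 (s t))//=; last by exists t.
rewrite indicE mem_set// mulr1 fsbig1 ?addr0//.
by move=> y [_ /= /nesym ys]; rewrite indicE memNset ?mulr0.
Qed.

Let indic_integrable (s : {fimfun T >-> V}) y : bochner_simple mu D s ->
  mu.-integrable D (EFin \o (fun t => phi y * \1_(s @^-1` [set y]) t)).
Proof.
move=> ss; have [ms _] := ss y.
have -> : EFin \o (fun t => phi y * \1_(s @^-1` [set y]) t) =
  (fun t => (phi y)%:E * (\1_(s @^-1` [set y]) t)%:E)%E by apply/funext.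
by apply: integrableZl => //; apply: integrableS (integrable_indic mu ms).
Qed.

Lemma simple_functional_integrable (s : {fimfun T >-> V}) : bochner_simple mu D s ->
  mu.-integrable D (EFin \o (fun t => phi (s t))).
Proof.
move=> ss; have -> : EFin \o (fun t => phi (s t)) =
  (fun t => \sum_(y <- finmap.enum_fset (fset_set (range s))) (phi y * \1_(s @^-1` [set y]) t)%:E)%E.
  by apply/funext => t /=; rewrite simple_functionalE sumEFin.
by apply: integrable_sum => // y _; exact: indic_integrable.
Qed.

Lemma simple_functional_integral (s : {fimfun T >-> V}) : bochner_simple mu D s ->
  phi (simple_bochner_integral mu D s) = \int[mu]_(t in D) phi (s t).
Proof.
move=> ss; rewrite /simple_bochner_integral fsbig_finite//=.
rewrite phi_sum /Rintegral.
under [in RHS]eq_integral do rewrite simple_functionalE -sumEFin.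
rewrite integral_sum//; last by move=> y; exact: indic_integrable.
have mufin A : measurable A -> mu A \is a fin_num by exact: fin_num_measure.
have intE y : (\int[mu]_(t in D) (phi y * \1_(s @^-1` [set y]) t)%:E =
    (phi y * fine (mu (D `&` s @^-1` [set y])))%:E)%E.
  have [ms _] := ss y; under eq_integral do rewrite EFinM.
  rewrite integralZl//; last by apply: integrableS (integrable_indic mu ms).
  by rewrite integral_indic// setIC EFinM fineK// mufin//; exact: measurableI.
by under [in RHS]eq_bigr do rewrite intE; rewrite sumEFin/=; apply: eq_bigr => y _; rewrite phiZ mulrC.
Qed.

(** The functional is continuous, and the integral of [|phi (s n) - phi F|] is at most a constant
    times that of [rnorm (F - s n)], which tends to 0. Any approximating sequence is allowed, so the
    one chosen in [bochner_integral] need not be known. *)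
Lemma bochner_approx_functional (s : nat -> {fimfun T >-> V}) (F : T -> V) (v : V) :
  bochner_approx mu D s F -> mu.-integrable D (EFin \o (fun t => phi (F t))) ->
  simple_bochner_integral mu D (s n) @[n --> \oo] --> v ->
  phi v = \int[mu]_(t in D) phi (F t).
Proof.
move=> [ss _ sF] iF /cvg_rnormP sv; apply/eqP; rewrite -subr_eq0 -normr_eq0 eq_le normr_ge0 andbT.
apply/ler_addgt0Pr => e e0; rewrite add0r.
pose K := `|C| + 1; have K0 : 0 < K by rewrite ltr_wpDl.
have phiK x : `|phi x| <= K * rnorm x.
  rewrite (le_trans (phiC x))// ler_wpM2r ?rnorm_ge0// (le_trans (ler_norm _))// lerDl.
  by [].
have e2K : 0 < e / 2 / K by rewrite !divr_gt0.
have [N1 N1P] := sv _ e2K.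
(* Convergence to 0 in the extended reals gives finiteness from [N2] on as well as convergence of
   the finite parts. *)
have [/fine_cvgP[[N2 _ N2P] /cvgrPdist_le /(_ _ e2K) [N3 _ N3P]]] := (sF, tt).
pose n := maxn N1 (maxn N2 N3).
have isn := simple_functional_integrable (ss n).
rewrite -(subrKA (phi (simple_bochner_integral mu D (s n)))) (le_trans (ler_normD _ _))//.
rewrite (splitr e) lerD//.
  rewrite -phiB (le_trans (phiK _))// mulrC -ler_pdivlMr//.
  by apply: N1P; rewrite leq_maxl.
rewrite simple_functional_integral// -RintegralB//.
have iB : mu.-integrable D (EFin \o (fun t => phi (s n t) - phi (F t))).
  by apply: (integrableB mD isn iF).
have iN := integrable_norm iB.
apply: (le_trans (le_normr_Rintegral mD iB)).
have n2 : (N2 <= n)%N by rewrite !leq_max leqnn orbT.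
have n3 : (N3 <= n)%N by rewrite !leq_max leqnn !orbT.
have fin_n := N2P n n2; have := N3P n n3.
rewrite /= sub0r normrN ger0_norm; last first.
  by rewrite fine_ge0// integral_ge0// => t _; rewrite lee_fin rnorm_ge0.
rewrite ler_pdivlMr// => h; apply: le_trans h.
(* The factor [K] is absorbed on the integrable side, because [rnorm (F t - s n t)] enters only
   through its lower integral. *)
rewrite mulrC -ler_pdivrMl// -RintegralZl// -lee_fin /Rintegral !fineK//; last first.
  by apply: integrable_fin_num => //; exact: (integrableZl mD K^-1 iN).
apply: ge0_le_lower_integral => t _; first by rewrite lee_fin mulr_ge0// invr_ge0 ltW.
by rewrite lee_fin ler_pdivrMl// -phiB rnormBC.
Qed.

End BochnerFunctional.

(** * Step functions approximating a uniformly continuous path *)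

Section StepApprox.
Variables (R : realType) (V : completeNormedModType R[i]).

(** The cap at [n.+1], together with truncation to 0 on the negative reals, leaves finitely many
    values on the whole line, as a simple function requires. *)
Definition grid_idx (n : nat) (t : R) : nat := minn (Num.truncn (n.+1%:R * t)) n.+1.

Definition grid_pt (n : nat) (t : R) : R := (grid_idx n t)%:R / n.+1%:R.

Lemma grid_pt_itv n t : 0 <= grid_pt n t <= 1.
Proof.
by rewrite divr_ge0//= ler_pdivrMr ?ltr0n// mul1r ler_nat geq_minr.
Qed.

Lemma grid_pt_dist n t : 0 <= t <= 1 -> `|grid_pt n t - t| <= n.+1%:R^-1.
Proof.
move=> /andP[t0 t1]; have N0 : 0 < n.+1%:R :> R by rewrite ltr0n.
have Nt0 : 0 <= n.+1%:R * t by rewrite mulr_ge0.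
have NtN : n.+1%:R * t <= n.+1%:R by rewrite ler_piMr.
have /andP[h1 h2] := truncn_itv Nt0.
have -> : grid_pt n t - t = ((Num.truncn (n.+1%:R * t))%:R - n.+1%:R * t) / n.+1%:R.
  rewrite /grid_pt /grid_idx (minn_idPl _); last by rewrite -(ler_nat R) (le_trans h1).
  by field; rewrite gt_eqF.
rewrite normrM normfV (gtr0_norm N0) ler_pdivrMr// mulVf ?gt_eqF// ler_norml.
by rewrite -[X in _ < X]natr1 in h2; apply/andP; split; lra.
Qed.

(** The index is monotone in [t], so its level sets are intervals. *)
Lemma measurable_grid_idx n (k : nat) : measurable [set t : R | grid_idx n t = k].
Proof.
apply: is_interval_measurable => t u /= tk uk z /andP[tz zu].
have mono a b : a <= b -> (grid_idx n a <= grid_idx n b)%N.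
  move=> ab; rewrite /grid_idx leq_min geq_minr andbT (leq_trans (geq_minl _ _))//.
  by apply: le_truncn; rewrite ler_pM2l ?ltr0n.
by apply/eqP; rewrite eqn_leq -[X in (_ <= X)%N && _]uk -[X in _ && (X <= _)%N]tk !mono.
Qed.

Variable F : R -> V.

Definition step (n : nat) (t : R) : V := F (grid_pt n t).

Lemma step_finite n : finite_set (range (step n)).
Proof.
apply: (@sub_finite_set _ _ ((fun k : nat => F (k%:R / n.+1%:R)) @` `I_n.+2)).
  by move=> _ [t _ <-]; exists (grid_idx n t) => //=; rewrite ltnS geq_minr.
by apply: finite_image; exact: finite_II.
Qed.

HB.instance Definition _ n := FiniteImage.Build R V (step n) (step_finite n).

Lemma bochner_simple_step (mu : {finite_measure set R -> \bar R}) (D : set R) n :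
  measurable D -> bochner_simple mu D (step n).
Proof.
move=> mD y.
have mstep : measurable (step n @^-1` [set y]).
  (* A union of level sets, because [F] may take the value [y] at several grid points. *)
  have -> : step n @^-1` [set y] =
      \bigcup_(k in [set k | F (k%:R / n.+1%:R) = y]) [set t : R | grid_idx n t = k].
    apply/seteqP; split=> t /=; first by move=> ty; exists (grid_idx n t).
    by move=> [k /= ky tk]; rewrite /step /grid_pt tk.
  by apply: bigcup_measurable => k _; exact: measurable_grid_idx.
split=> // _; rewrite ltey_eq fin_num_measure//; exact: measurableI.
Qed.

Hypothesis F_unif : forall e : R, 0 < e -> exists2 d : R, 0 < d &
  forall s t : R, 0 <= s <= 1 -> 0 <= t <= 1 -> `|s - t| < d -> rnorm (F s - F t) <= e.

Lemma step_unif (e : R) : 0 < e -> exists N, forall n, (N <= n)%N ->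
  forall t, 0 <= t <= 1 -> rnorm (F t - step n t) <= e.
Proof.
move=> e0; have [d d0 dP] := F_unif e0.
have [N _ NP] := @near_infty_natSinv_lt R (PosNum d0).
exists N => n Nn t t01; apply: dP => //; first exact: grid_pt_itv.
by rewrite distrC (le_lt_trans (grid_pt_dist n t01))//; exact: (NP n Nn).
Qed.

Lemma bochner_approx_step (mu : {finite_measure set R -> \bar R}) :
  bochner_approx mu `[0, 1] step F.
Proof.
split.
- by move=> n; exact: bochner_simple_step.
- apply: aeW => t /=; rewrite in_itv/= => t01.
  by apply/cvg_rnormP => e /step_unif[N NP]; exists N => n Nn; exact: NP.
- pose m := fine (mu `[0, 1]%classic); have mE : mu `[0, 1]%classic = m%:E by rewrite fineK// fin_num_measure.
  have m0 : 0 <= m by rewrite fine_ge0.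
  have int_le (e : R) : 0 < e -> exists N, forall n, (N <= n)%N ->
      (0 <= \int[mu]_(t in `[0%R, 1%R]) (rnorm (F t - step n t))%:E <= e%:E)%E.
    (* Dividing by [m + 1] allows the mass [m] of the interval to be 0. *)
    move=> e0; have e0' : 0 < e / (m + 1) by rewrite divr_gt0// ltr_wpDl.
    have [N NP] := step_unif e0'; exists N => n Nn.
    have r0 t : (0 <= (rnorm (F t - step n t))%:E)%E by rewrite lee_fin rnorm_ge0.
    rewrite integral_ge0//=.
    apply: (@le_trans _ _ (\int[mu]_(t in `[0%R, 1%R]) (e / (m + 1))%:E)%E).
      by apply: ge0_le_lower_integral => // t /=; rewrite in_itv/= lee_fin => t01; exact: NP.
    rewrite integral_cst//= [X in (_ * X)%E]mE -EFinM lee_fin mulrAC.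
    by rewrite ler_pdivrMr ?ltr_wpDl// ler_pM2l// lerDl.
  apply/fine_cvgP; split.
    have [N NP] := int_le 1 ltr01; exists N => // n /= /NP /andP[h0 h1].
    by rewrite fin_numElt (lt_le_trans _ h0) ?ltNyr//= (le_lt_trans h1) ?ltry.
  apply/cvgrPdist_le => e e0; have [N NP] := int_le e e0; exists N => // n /= /NP /andP[h0 h1].
  rewrite sub0r normrN ger0_norm ?fine_ge0// -lee_fin fineK//.
  by rewrite fin_numElt (lt_le_trans _ h0) ?ltNyr//= (le_lt_trans h1) ?ltry.
Qed.

End StepApprox.

(** * The Bochner integral of a uniformly continuous path of symmetric operators *)

Section BochnerOperator.
Variables (R : realType) (H : hilbertType R) (mu : probability R R).
Hypothesis mu01 : mu `[0, 1]%classic = 1%E.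
Variable F : R -> bop H.
Hypothesis F_sym : forall t, 0 <= t <= 1 -> symop (F t).
Hypothesis F_unif : forall e : R, 0 < e -> exists2 d : R, 0 < d &
  forall s t : R, 0 <= s <= 1 -> 0 <= t <= 1 -> `|s - t| < d -> rnorm (F s - F t) <= e.

Local Notation D := (`[0, 1]%classic : set R).
Local Notation v := (bochner_integral mu D F).

Lemma within_itv_lipschitz (phi : bop H -> R) (C : R) :
  (forall S T, `|phi S - phi T| <= C * rnorm (S - T)) ->
  {within `[0, 1], continuous (fun t => phi (F t))}.
Proof.
move=> phiC; apply/subspace_continuousP => t /=; rewrite in_itv/= => t01.
apply/cvgrPdist_le => e e0; rewrite near_withinE.
have C1 : 0 < `|C| + 1 by rewrite ltr_wpDl.
have [d d0 dP] := F_unif (divr_gt0 e0 C1).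
apply/nbhs_ballP; exists d => // u tu; rewrite /= in_itv/= => u01.
apply: (le_trans (phiC _ _)); have := dP _ _ t01 u01 tu; rewrite ler_pdivlMr//.
apply: le_trans; rewrite mulrC ler_wpM2l ?rnorm_ge0// (le_trans (ler_norm _))// lerDl.
by [].
Qed.

Lemma rdot_bop_functional (x y : H) :
  [/\ forall S T : bop H, rdot ((S + T) x) y = rdot (S x) y + rdot (T x) y,
      forall (r : R) (T : bop H), rdot ((r%:C *: T) x) y = r * rdot (T x) y &
      forall T : bop H, `|rdot (T x) y| <= rnorm x * rnorm y * rnorm T].
Proof.
split=> [S T|r T|T]; first by rewrite bopDE rdotDl.
  by rewrite bopZE rdotZl.
by rewrite mulrC rdot_bop_le.
Qed.

Lemma rdot_itv_continuous (x y : H) :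
  {within `[0, 1], continuous (fun t => rdot (F t x) y)}.
Proof.
apply: (@within_itv_lipschitz (fun T => rdot (T x) y) (rnorm x * rnorm y)) => S T.
by rewrite -rdotBl -bopBE; have [_ _] := rdot_bop_functional x y; exact.
Qed.

(** The defect of symmetry as a functional: it vanishes at symmetric operators, and since it
    commutes with integrals it vanishes at their integrals. *)
Lemma skew_functional (x y : H) (psi := fun T : bop H => rdot (T x) y - rdot x (T y)) :
  [/\ forall S T, psi (S + T) = psi S + psi T,
      forall (r : R) T, psi (r%:C *: T) = r * psi T &
      forall T, `|psi T| <= (2 * (rnorm x * rnorm y)) * rnorm T].
Proof.
split=> [S T|r T|T]; rewrite /psi.
- by rewrite !bopDE !rdotE; ring.
- by rewrite !bopZE !rdotE; ring.
- rewrite (le_trans (ler_normB _ _))// (rdotC x).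
  have := rdot_bop_le T x y; have := rdot_bop_le T y x; lra.
Qed.

Let mD : measurable D. Proof. exact: measurable_itv. Qed.

Let approx : bochner_approx mu D (step F) F.
Proof. exact: (bochner_approx_step F_unif mu). Qed.

Let simple n : bochner_simple mu D (step F n).
Proof. exact: (bochner_simple_step F mu n mD). Qed.

Lemma symop_simple_step n : symop (simple_bochner_integral mu D (step F n)).
Proof.
move=> x y; have [psiD psiZ psiC] := skew_functional x y.
have := simple_functional_integral mD psiD psiZ (simple n).
rewrite (@eq_Rintegral _ _ _ mu D (fun=> 0)); last first.
  by move=> t _; rewrite /step F_sym ?subrr// grid_pt_itv.
by rewrite Rintegral_cst// mul0r => /eqP; rewrite subr_eq0 => /eqP.
Qed.

(** The integrals are symmetric, so the norm of a difference is controlled by its quadratic form.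
    That form is a scalar integral, at most [e |x|^2] because the mass is 1 and the two steps are
    each within [e / 2] of [F]. *)
Lemma simple_step_cvg : cvg (simple_bochner_integral mu D (step F n) @[n --> \oo]).
Proof.
apply: rnorm_cauchy_cvg => e e0; have e20 : 0 < e / 2 by rewrite divr_gt0.
have [N NP] := step_unif F_unif e20; exists N => m n Nm Nn.
apply: opnorm_sym_le; first exact: ltW.
  by apply: symopB; exact: symop_simple_step.
move=> x; have [phiD phiZ phiC] := rdot_bop_functional x x.
have ipm := simple_functional_integrable mD (fun T : bop H => rdot (T x) x) (simple m).
have ipn := simple_functional_integrable mD (fun T : bop H => rdot (T x) x) (simple n).
rewrite bopBE rdotBl !(simple_functional_integral mD phiD phiZ (simple _)).
rewrite -RintegralB//.
have iB : mu.-integrable D (EFin \o (fun t => rdot (step F m t x) x - rdot (step F n t x) x)).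
  by apply: (integrableB mD ipm ipn).
apply: (le_trans (le_normr_Rintegral mD iB)).
have -> : e * rnorm x ^+ 2 = \int[mu]_(t in D) (e * rnorm x ^+ 2).
  by rewrite Rintegral_cst// [X in fine X]mu01 mulr1.
apply: le_Rintegral => //.
- exact: integrable_norm iB.
- by apply: within_itv_integrable; apply: continuous_subspaceT => t; exact: cvg_cst.
- move=> t /=; rewrite in_itv/= => t01; rewrite -rdotBl -bopBE (le_trans (phiC _))//.
  rewrite mulrC -expr2 ler_wpM2r ?sqr_ge0// (le_trans (rnormB_trans (F t) _ _))//.
  have hm := NP m Nm t t01; have hn := NP n Nn t t01.
  by rewrite rnormBC in hm; rewrite (splitr e); exact: lerD hm hn.
Qed.

(** Convergence of the step integrals rules out the default value, so [v] is the limit for some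
    approximating sequence, and [bochner_approx_functional] covers them all. *)
Lemma bochner_integral_functional (phi : bop H -> R) (C : R) :
  (forall S T, phi (S + T) = phi S + phi T) ->
  (forall (r : R) T, phi (r%:C *: T) = r * phi T) ->
  (forall T, `|phi T| <= C * rnorm T) ->
  phi v = \int[mu]_(t in D) phi (F t).
Proof.
move=> phiD phiZ phiC.
have : [set w | exists2 s : nat -> {fimfun R >-> bop H}, bochner_approx mu D s F &
    simple_bochner_integral mu D (s n) @[n --> \oo] --> w] v.
  apply: (@xgetPex _ (0 : bop H)); have /cvg_ex[w wP] := simple_step_cvg.
  by exists w, (step F) => //; exact: approx.
move=> [s sF sv]; apply: (bochner_approx_functional mD phiD phiZ phiC sF _ sv).
apply: within_itv_integrable; apply: (@within_itv_lipschitz phi C) => S T.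
have -> : phi S - phi T = phi (S - T); last exact: phiC.
have -> : - T = (-1)%:C *: T by rewrite rmorphN1 scaleN1r.
by rewrite phiD phiZ mulN1r.
Qed.

Lemma symop_bochner_integral : symop v.
Proof.
move=> x y; have [psiD psiZ psiC] := skew_functional x y.
have := bochner_integral_functional psiD psiZ psiC.
rewrite (@eq_Rintegral _ _ _ mu D (fun=> 0)); last first.
  by move=> t; rewrite inE/= in_itv/= => t01; rewrite F_sym ?subrr.
by rewrite Rintegral_cst// mul0r => /eqP; rewrite subr_eq0 => /eqP.
Qed.

Lemma rdot_bochner_integral x y : rdot (v x) y = \int[mu]_(t in D) rdot (F t x) y.
Proof.
have [phiD phiZ phiC] := rdot_bop_functional x y.
exact: (bochner_integral_functional phiD phiZ phiC).
Qed.

Lemma bochner_integrable_unif : bochner_integrable mu D F.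
Proof. by exists (step F); exact: approx. Qed.

End BochnerOperator.

(** * The two operator inequalities, from their quadratic forms *)

Section HermiteHadamard.
Variables (R : realType) (H : hilbertType R) (I : set R) (f : R -> R).
Hypotheses (I_neq0 : I !=set0) (I_itv : is_interval I)
  (f_cont : {within I, continuous f}).
Variables (l : R) (l01 : 0 < l < 1) (A B : bop H).
Hypotheses (IA : selfadjoint_in I A) (IB : selfadjoint_in I B).

Local Notation F := (fun t : R => cfc f (nabla t A B)).
Local Notation v := (bochner_integral (eta l01) `[0, 1] F).

Let F_sym t : 0 <= t <= 1 -> symop (F t).
Proof. exact: (symop_cfc_nabla I_neq0 I_itv IA IB f_cont). Qed.

Let F_unif := cfc_nabla_unif I_neq0 I_itv IA IB f_cont.

Lemma nabla0 : nabla 0 A B = A.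
Proof. by rewrite /nabla subr0 scale1r scale0r addr0. Qed.

Lemma nabla1 : nabla 1 A B = B.
Proof. by rewrite /nabla subrr scale1r scale0r add0r. Qed.

Lemma symop_eta_integral : symop v.
Proof. exact: (symop_bochner_integral (eta_itv01 l01) F_sym F_unif). Qed.

(** Two vectors are kept so that [y = x] serves the convex case and [y = - x], which changes the
    sign of the form, the concave one. *)
Lemma rdot_eta_jensen x y :
  (forall s t u : R, 0 <= s <= 1 -> 0 <= t <= 1 -> 0 <= u <= 1 ->
    rdot (F ((1 - s) * t + s * u) x) y <= (1 - s) * rdot (F t x) y + s * rdot (F u x) y) ->
  rdot (F l x) y <= rdot (v x) y <= rdot (nabla l (cfc f A) (cfc f B) x) y.
Proof.
move=> conv.
have gc := @rdot_itv_continuous _ _ _ F_unif x y.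
rewrite (rdot_bochner_integral (eta_itv01 l01) F_sym F_unif); apply/andP; split.
  exact: (eta_jensen_ge l01 gc conv).
have := eta_jensen_le l01 gc conv; rewrite nabla0 nabla1 => /le_trans; apply.
by rewrite /nabla bopDE !bopZE rdotDl !rdotZl.
Qed.

Lemma operator_convex_rdot x : operator_convex H I f ->
  forall s t u : R, 0 <= s <= 1 -> 0 <= t <= 1 -> 0 <= u <= 1 ->
    rdot (F ((1 - s) * t + s * u) x) x <= (1 - s) * rdot (F t x) x + s * rdot (F u x) x.
Proof.
move=> fconv s t u s01 t01 u01.
have It := selfadjoint_in_nabla I_neq0 I_itv IA IB t01.
have Iu := selfadjoint_in_nabla I_neq0 I_itv IA IB u01.
have /(positive_op_ge0 x) := fconv _ _ _ It Iu s01.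
by rewrite nabla_nabla bopBE rdotBl subr_ge0 /nabla bopDE !bopZE rdotDl !rdotZl.
Qed.

Lemma operator_concave_rdot x : operator_concave H I f ->
  forall s t u : R, 0 <= s <= 1 -> 0 <= t <= 1 -> 0 <= u <= 1 ->
    rdot (F ((1 - s) * t + s * u) x) (- x) <=
      (1 - s) * rdot (F t x) (- x) + s * rdot (F u x) (- x).
Proof.
move=> fconc s t u s01 t01 u01; rewrite !rdotNr !mulrN -opprD lerN2.
have It := selfadjoint_in_nabla I_neq0 I_itv IA IB t01.
have Iu := selfadjoint_in_nabla I_neq0 I_itv IA IB u01.
have /(positive_op_ge0 x) := fconc _ _ _ It Iu s01.
by rewrite nabla_nabla bopBE rdotBl subr_ge0 /nabla bopDE !bopZE rdotDl !rdotZl.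
Qed.

Let sl : symop (F l).
Proof. by apply: F_sym; case/andP: l01 => ? ?; rewrite !ltW. Qed.

Let sn : symop (nabla l (cfc f A) (cfc f B)).
Proof.
have z01 : 0 <= (0 : R) <= 1 by rewrite lexx ler01.
have o01 : 0 <= (1 : R) <= 1 by rewrite lexx ler01.
(* The endpoints of the path give the symmetry of [cfc f A] and [cfc f B]. *)
have := F_sym z01; have := F_sym o01; rewrite nabla0 nabla1 => sB sA.
by apply: symopD; apply: symopZ.
Qed.

Lemma hermite_hadamard_convex : operator_convex H I f ->
  [/\ bochner_integrable (eta l01) `[0, 1] F, ople (F l) v &
      ople v (nabla l (cfc f A) (cfc f B))].
Proof.
move=> fconv; have sv := symop_eta_integral.
have h x := rdot_eta_jensen (operator_convex_rdot x fconv).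
split; first exact: (bochner_integrable_unif _ F_unif).
  apply: positive_opP => [|x]; first exact: symopB.
  by rewrite bopBE rdotBl subr_ge0; case/andP: (h x).
apply: positive_opP => [|x]; first exact: symopB.
by rewrite bopBE rdotBl subr_ge0; case/andP: (h x).
Qed.

Lemma hermite_hadamard_concave : operator_concave H I f ->
  [/\ bochner_integrable (eta l01) `[0, 1] F, ople v (F l) &
      ople (nabla l (cfc f A) (cfc f B)) v].
Proof.
move=> fconc; have sv := symop_eta_integral.
have h x := rdot_eta_jensen (operator_concave_rdot x fconc).
split; first exact: (bochner_integrable_unif _ F_unif).
  apply: positive_opP => [|x]; first exact: symopB.
  by rewrite bopBE rdotBl subr_ge0 -lerN2 -!rdotNr; case/andP: (h x).
apply: positive_opP => [|x]; first exact: symopB.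
by rewrite bopBE rdotBl subr_ge0 -lerN2 -!rdotNr; case/andP: (h x).
Qed.

End HermiteHadamard.

Theorem theorem2p1 (R : realType) (H : hilbertType R) (I : set R) (f : R -> R)
    (I_neq0 : I !=set0) (I_itv : is_interval I)
    (f_cont : {within I, continuous f}) :
  (operator_convex H I f ->
    forall (l : R) (l01 : 0 < l < 1) (A B : bop H),
      selfadjoint_in I A -> selfadjoint_in I B ->
      let F := fun t : R => cfc f (nabla t A B) in
      [/\ bochner_integrable (eta l01) `[0, 1] F,
          ople (cfc f (nabla l A B)) (bochner_integral (eta l01) `[0, 1] F) &
          ople (bochner_integral (eta l01) `[0, 1] F)
               (nabla l (cfc f A) (cfc f B))])
  /\
  (operator_concave H I f ->
    forall (l : R) (l01 : 0 < l < 1) (A B : bop H),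
      selfadjoint_in I A -> selfadjoint_in I B ->
      let F := fun t : R => cfc f (nabla t A B) in
      [/\ bochner_integrable (eta l01) `[0, 1] F,
          ople (bochner_integral (eta l01) `[0, 1] F) (cfc f (nabla l A B)) &
          ople (nabla l (cfc f A) (cfc f B))
               (bochner_integral (eta l01) `[0, 1] F)]).
Proof.
split=> [fconv|fconc] l l01 A B IA IB F.
  exact: (hermite_hadamard_convex I_neq0 I_itv f_cont l01 IA IB fconv).
exact: (hermite_hadamard_concave I_neq0 I_itv f_cont l01 IA IB fconc).
Qed.
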